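(* Let $H=L^2(\mathbb R)$, let $(S_t\eta)(x)=\eta(x+t)$, $t\in\mathbb R$, and let $H_{0]}=L^2(\mathbb R_+)$ and $H_{[0}=L^2(\mathbb R_-)$ be regarded as subspaces of $H$. Let $\lambda_k$, $1\le k\le N\le+\infty$, be complex numbers with $\operatorname{Re}\lambda_k<0$, $\sum_{k=1}^N|\operatorname{Re}\lambda_k|<+\infty$ and arbitrary imaginary parts, and let $$\Theta(\lambda)=\prod_{k=1}^N\frac{\lambda+\overline{\lambda_k}}{\lambda-\lambda_k}$$ be the corresponding Blaschke product. Let $\mathcal V=M_\Theta H_{0]}$ be the corresponding subspace of $H_{0]}$ invariant with respect to the right shifts $S_{-t}|_{H_{0]}}$, $t\ge0$; it is determined by the condition of orthogonality to all exponents $e^{\lambda_kx}$, $1\le k\le N$. Let $\mathcal V^\perp$ be the orthogonal complement of $\mathcal V$ in $H_{0]}$, and let $g_k$, $1\le k\le N$, be the orthonormal basis of $\mathcal V^\perp$ obtained by successive orthogonalization of the system $e^{\lambda_kx}$, $(g_k,g_l)=\delta_{kl}$. Define a strongly continuous semigroup of unitaries $R=(R_t)_{t\in\mathbb R_+}$ in $\mathcal V^\perp$ by $$R_tg_k=e^{i\operatorname{Im}\lambda_k\,t}g_k,\quad 1\le k\le N,\ t\in\mathbb R_+.$$ Let $W=(W_t)_{t\in\mathbb R}$ be the Markovian cocycle associated with $\Theta$ and $R$, i.e. for $t\ge0$ $$W_{-t}\eta=(R_tP_{\mathcal V^\perp}S_t-P_{\mathcal V})P_{[t,+\infty)}\eta+M_\Theta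 P_{[0,t]}\eta,\ \eta\in H_{0]},\qquad W_{-t}\eta=\eta,\ \eta\in H_{[0},$$ and $W_t=S_tW_{-t}^*S_{-t}$. Then $W$ is inner, i.e. $W_t-I\in s_2$ for all $t\in\mathbb R$, where $s_2$ is the Hilbert–Schmidt class.
   Context: $P_{[0,t]}$, $P_{[t,+\infty)}$, $P_{\mathcal V}$, $P_{\mathcal V^\perp}$ are the orthogonal projections onto the functions supported in $[0,t]$, onto the functions supported in $[t,+\infty)$, onto $\mathcal V$ and onto $\mathcal V^\perp$. $M_\Theta=\mathcal L^{-1}\Theta\mathcal L$ on $L^2(\mathbb R_+)$, where $\mathcal L$ is the Laplace transformation and $\Theta$ stands for multiplication by the function $\Theta(\lambda)$; since $\Theta$ is analytic in $\operatorname{Re}\lambda>0$ with modulus one on the imaginary axis, $M_\Theta$ is an isometry. A Markovian cocycle (for the group $S$) is a strongly continuous family of unitaries $(W_t)_{t\in\mathbb R}$ in $H$ with $W_0=I$, $W_{t+s}=W_tS_tW_sS_t^*$ for $s,t\in\mathbb R$, and $W_tf=f$ for every $t>0$ and every $f$ supported in $(-\infty,-t]$.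
   Formalization: W_{-t} is taken with S_{-t}P_V S_t in place of −P_V (as printed, W_0 would be P_{V^⊥}−P_V on H_{0]}, not I), and R_t g_k = e^{−i Im λ_k t} g_k in place of e^{i Im λ_k t} g_k; the printed version is stated too, but no Markovian cocycle satisfies it. *)

(* Defs.v *)
From HB Require Import structures.
From mathcomp Require Import all_boot all_order all_algebra.
From mathcomp Require Import all_classical all_reals all_analysis.
From mathcomp Require Import complex.

Set Implicit Arguments.
Unset Strict Implicit.
Unset Printing Implicit Defensive.

Import Order.TTheory GRing.Theory Num.Theory.
Import numFieldNormedType.Exports.

Local Open Scope classical_set_scope.
Local Open Scope ring_scope.
Local Open Scope complex_scope.

(* Vectors of L^2(R, C) are represented by square-integrable functions
   R -> R[i]; equality of vectors is equality almost everywhere, and operators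
   act on representatives. *)

Section L2.
Variable R : realType.
Notation C := R[i].
Notation mu := (@lebesgue_measure R).
Implicit Types (f h : R -> C) (D : set R) (K : set (R -> C)).

Definition fn := R -> C.
Definition op := fn -> fn.

Definition eqae f h := {ae mu, forall x, f x = h x}.

Definition L2 : set (R -> C) :=
  [set f | ((fun x => complex.Re (f x)) \in Lfun mu 2%:E) /\
           ((fun x => complex.Im (f x)) \in Lfun mu 2%:E)].

Definition cintegral D f : C :=
  (\int[mu]_(x in D) complex.Re (f x)) +i* (\int[mu]_(x in D) complex.Im (f x)).

Definition inner f h : C := cintegral setT (fun x => f x * conjc (h x)).

Definition norm2 f : R := Num.sqrt (complex.Re (inner f f)).

Definition supported D f := {ae mu, forall x, ~ D x -> f x = 0}.

Definition L2on D : set (R -> C) := [set f | L2 f /\ supported D f].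

Definition restr D : op := fun f x => if x \in D then f x else 0.

Definition Hplus := L2on `[0, +oo[.
Definition Hminus := L2on `]-oo, 0].

Definition tshift (t : R) : op := fun f x => f (x + t).

Definition maps_to K T := forall f, K f -> K (T f).

Definition linear_on K (T : op) := forall (a : C) f h, K f -> K h ->
  eqae (T ((a \*o f) \+ h)) ((a \*o T f) \+ T h).

Definition is_unitary_on K (T : op) :=
  [/\ maps_to K T, linear_on K T,
      (forall f h, K f -> K h -> inner (T f) (T h) = inner f h) &
      (forall h, K h -> exists2 f, K f & eqae (T f) h)].

Definition is_adjoint (T A : op) :=
  maps_to L2 A /\
  forall f h, L2 f -> L2 h -> inner (T f) h = inner f (A h).

Definition is_orth_projection K (P : op) := forall f, L2 f ->
  K (P f) /\ forall h, K h -> inner (f \- P f) h = 0.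

Definition strongly_continuous (D : set R) K (T : R -> op) :=
  forall f t0, K f -> D t0 ->
    norm2 (T t f \- T t0 f) @[t --> within D (nbhs t0)] --> (0 : R).

(* [J] is the index set: all of [nat], or an initial segment of it. *)
Definition orthonormal (J : pred nat) (e : nat -> fn) :=
  (forall k, J k -> L2 (e k)) /\
  forall k l, J k -> J l -> inner (e k) (e l) = (k == l)%:R.

Definition is_orthonormal_basis K (J : pred nat) (e : nat -> fn) :=
  [/\ orthonormal J e, (forall k, J k -> K (e k)) &
      (forall f, K f -> (forall k, J k -> inner f (e k) = 0) ->
        eqae f (fun=> 0))].

(* L^2(R, C) is separable and infinite dimensional, so that its orthonormal
   bases are sequences; the value of the series is the same for all of them. *)
Definition hilbert_schmidt (T : op) :=
  [/\ maps_to L2 T, linear_on L2 T,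
      (exists c : R, forall f, L2 f -> norm2 (T f) <= c * norm2 f) &
      (forall e, is_orthonormal_basis L2 predT e ->
        (\sum_(0 <= n <oo) (norm2 (T (e n)) ^+ 2)%:E < +oo)%E)].

(* The adjoint of [tshift t] is [tshift (- t)]. *)
Definition markovian_cocycle (W : R -> op) :=
  [/\ (forall t, is_unitary_on L2 (W t)),
      strongly_continuous setT L2 W,
      (forall f, L2 f -> eqae (W 0 f) f),
      (forall s t f, L2 f ->
        eqae (W (t + s) f) (W t (tshift t (W s (tshift (- t) f))))) &
      (forall t f, 0 < t -> L2on `]-oo, - t] f -> eqae (W t f) f)].

Definition unitary_semigroup K (U : R -> op) :=
  [/\ (forall t, 0 <= t -> is_unitary_on K (U t)),
      strongly_continuous [set t | 0 <= t] K U,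
      (forall f, K f -> eqae (U 0 f) f) &
      (forall s t f, 0 <= s -> 0 <= t -> K f ->
        eqae (U (t + s) f) (U t (U s f)))].

Definition inner_cocycle (W : R -> op) :=
  forall t, hilbert_schmidt (fun f => W t f \- f).

Definition cexp (z : C) : C :=
  (expR (complex.Re z) * cos (complex.Im z)) +i*
  (expR (complex.Re z) * sin (complex.Im z)).

Definition exponent (z : C) : fn :=
  restr `[0, +oo[ (fun x => cexp (z * x%:C)).

Definition laplace f (z : C) : C :=
  cintegral `[0, +oo[ (fun x => cexp (- (z * x%:C)) * f x).

(* [M] is the operator of multiplication by [Theta] after Laplace
   transformation; a vector of [Hplus] is determined by its Laplace transform
   on the right half-plane. *)
Definition is_multiplier (Theta : C -> C) (M : op) := forall f, Hplus f ->
  Hplus (M f) /\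
  forall z, 0 < complex.Re z -> laplace (M f) z = Theta z * laplace f z.

Definition climit (u : nat -> C) : C :=
  lim (complex.Re (u n) @[n --> \oo]) +i* lim (complex.Im (u n) @[n --> \oo]).

(* The sequences indexed by 1 <= k <= N are indexed here by k < N; [None]
   stands for N = +oo. *)
Definition in_range (N : option nat) : pred nat :=
  fun k => if N is Some n then (k < n)%N else true.

(* Summability of the real parts makes the product converge on the right
   half-plane without convergence factors. *)
Definition blaschke (N : option nat) (lam : nat -> C) (z : C) : C :=
  climit (fun n =>
    \prod_(0 <= k < n | in_range N k) ((z + conjc (lam k)) / (z - lam k))).

Definition range_space (M : op) : set (R -> C) :=
  [set f | L2 f /\ exists2 h, Hplus h & eqae f (M h)].

Definition complement K : set (R -> C) :=
  [set f | Hplus f /\ forall h, K h -> inner f h = 0].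

Definition gram_schmidt (J : pred nat) (e g : nat -> fn) :=
  forall k, J k ->
    let u := fun x => e k x - \sum_(j < k) inner (e k) (g j) * g j x in
    eqae (g k) (fun x => ((norm2 u)^-1)%:C * u x).

(* [B t] is the action of [W (- t)] on the functions supported in
   [t, +oo[. *)
Definition extends_to_cocycle (B : R -> op) (M : op) (W : R -> op) :=
  [/\ (forall t f, 0 <= t -> Hplus f ->
        eqae (W (- t) f) (B t (restr `[t, +oo[ f) \+ M (restr `[0, t] f))),
      (forall t f, 0 <= t -> Hminus f -> eqae (W (- t) f) f) &
      (forall t, 0 <= t -> exists2 A, is_adjoint (W (- t)) A &
        forall f, L2 f -> eqae (W t f) (tshift t (A (tshift (- t) f))))].

End L2.

(* Main.v *)
From HB Require Import structures.
Require Import Defs.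
From mathcomp Require Import all_boot all_order all_algebra.
From mathcomp Require Import all_classical all_reals all_analysis.
From mathcomp Require Import measurable_realfun complex ring lra.

(* For [t >= 0] the difference [W (- t) - I] splits, on the functions supported
   in [0, +oo[, into [(U_t - S_{-t}) P_{V^perp} S_t P_{[t, +oo[}] and
   [(M - I) P_{[0, t]}]; it vanishes on the functions supported in ]-oo, 0].
   The vectors [g_k] have the Laplace transforms
   [c_k Theta_k(z) / (z - lambda_k)], where [Theta_k] is the product of the first
   factors of [Theta] and [|c_k|^2 = 2 |Re lambda_k|].  Hence [Theta - 1] is the
   Laplace transform of a square-integrable function [k], the sum of multiples
   of the [g_k] with squared norms [2 |Re lambda_k|], and [(M - I) P_{[0, t]}] is
   convolution with [k], whose squared Hilbert-Schmidt norm is [t ||k||^2].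
   As [(g_k, S_{-t} g_k) = exp (lambda_k t)], the other term has squared
   Hilbert-Schmidt norm [sum_k 2 (1 - exp (t Re lambda_k))], which is at most
   [2 t sum_k |Re lambda_k|].  Both norms are bounded by applying Bessel's
   inequality pointwise under the integral.  Finally [W t - I] and
   [W (- t) - I] have the same norm since [W (- t)] is normal. *)

Set Implicit Arguments.
Unset Strict Implicit.
Unset Printing Implicit Defensive.

Import Order.TTheory GRing.Theory Num.Theory.
Import numFieldNormedType.Exports.

Local Open Scope classical_set_scope.
Local Open Scope ring_scope.
Local Open Scope complex_scope.

(** * Square-integrable complex functions *)

(** The two halves of the statement differ in kind: the formula of the first contradicts W_0 = I,
    and the estimates serve the second. The function [k] comes from telescoping: since 2 Re lambda_k
    = (z + conj lambda_k) - (z - lambda_k), a suitable multiple of the transform of g_k is the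
    difference of two successive partial products. Summability of |Re lambda_k| thus enters as
    square-summability of coefficients, and evaluation of the transform at z, being an inner product
    with an exponential, passes to the limit. The operator [M] is known only through Laplace
    transforms, so its identification with a convolution rests on their injectivity. The phase of
    R_t is what makes the other term summable for arbitrary Im lambda_k: it cancels the phase of
    (g_k, S_{-t} g_k) exactly. *)

Section Integrals.
Variable R : realType.
Notation C := R[i].
Notation Re := (@complex.Re R).
Notation Im := (@complex.Im R).
Notation mu := (@lebesgue_measure R).
Implicit Types (f h k : R -> C) (D : set R).

Lemma Re_add (x y : C) : Re (x + y) = Re x + Re y. Proof. by case: x y => ? ? []. Qed.
Lemma Im_add (x y : C) : Im (x + y) = Im x + Im y. Proof. by case: x y => ? ? []. Qed.
Lemma Re_opp (x : C) : Re (- x) = - Re x. Proof. by case: x. Qed.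
Lemma Im_opp (x : C) : Im (- x) = - Im x. Proof. by case: x. Qed.
Lemma Re_mul (x y : C) : Re (x * y) = Re x * Re y - Im x * Im y.
Proof. by case: x y => ? ? []. Qed.
Lemma Im_mul (x y : C) : Im (x * y) = Re x * Im y + Im x * Re y.
Proof. by case: x y => ? ? []. Qed.
Lemma Re_conjc (x : C) : Re (conjc x) = Re x. Proof. by case: x. Qed.
Lemma Im_conjc (x : C) : Im (conjc x) = - Im x. Proof. by case: x. Qed.
Lemma complexP (x y : C) : Re x = Re y -> Im x = Im y -> x = y.
Proof. by case: x y => a b [c d] /= -> ->. Qed.
Definition ReImE := (Re_add, Im_add, Re_opp, Im_opp, Re_mul, Im_mul, Re_conjc, Im_conjc).

(** Real-valued, whereas the norm of [R[i]] takes values in [R[i]]; integrands and estimates thus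
    stay over [R]. *)
Definition csq (x : C) : R := Re x ^+ 2 + Im x ^+ 2.

Lemma csq_ge0 x : 0 <= csq x. Proof. by rewrite addr_ge0 ?sqr_ge0. Qed.

Lemma csqM x y : csq (x * y) = csq x * csq y.
Proof. rewrite /csq !ReImE; ring. Qed.

Lemma csq_conj x : csq (conjc x) = csq x.
Proof. rewrite /csq !ReImE; ring. Qed.

Lemma csqE x : x * conjc x = (csq x)%:C.
Proof. by apply: complexP; rewrite !ReImE /csq /=; ring. Qed.

Lemma csq_eq0 x : csq x = 0 -> x = 0.
Proof.
move=> /eqP; rewrite paddr_eq0 ?sqr_ge0// !sqrf_eq0 => /andP[/eqP r /eqP i].
exact: complexP.
Qed.

(** The two sides differ by [csq (x - y)], by the parallelogram law. *)
Lemma csqD_le x y : csq (x + y) <= 2 * (csq x + csq y).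
Proof.
rewrite -subr_ge0 (_ : _ - _ = csq (x - y)) ?csq_ge0// /csq !ReImE; ring.
Qed.

Definition cmeas f := measurable_fun setT (Re \o f) /\ measurable_fun setT (Im \o f).

Definition cint f :=
  mu.-integrable setT (EFin \o (Re \o f)) /\ mu.-integrable setT (EFin \o (Im \o f)).


Lemma cmeasD f h : cmeas f -> cmeas h -> cmeas (fun x => f x + h x).
Proof.
move=> [a b] [c d]; split.
  rewrite (_ : _ \o _ = (Re \o f) \+ (Re \o h)); first exact: measurable_funD.
  by apply/funext => x /=; rewrite Re_add.
rewrite (_ : _ \o _ = (Im \o f) \+ (Im \o h)); first exact: measurable_funD.
by apply/funext => x /=; rewrite Im_add.
Qed.

Lemma cmeasM f h : cmeas f -> cmeas h -> cmeas (fun x => f x * h x).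
Proof.
move=> [a b] [c d]; split.
  rewrite (_ : _ \o _ = ((Re \o f) \* (Re \o h)) \- ((Im \o f) \* (Im \o h))).
    by apply: measurable_funB; exact: measurable_funM.
  by apply/funext => x /=; rewrite Re_mul.
rewrite (_ : _ \o _ = ((Re \o f) \* (Im \o h)) \+ ((Im \o f) \* (Re \o h))).
  by apply: measurable_funD; exact: measurable_funM.
by apply/funext => x /=; rewrite Im_mul.
Qed.

Lemma cmeas_cst (a : C) : cmeas (fun=> a).
Proof. by split; exact: measurable_cst. Qed.

Lemma cmeas_conj f : cmeas f -> cmeas (fun x => conjc (f x)).
Proof.
move=> [a b]; split.
  by rewrite (_ : _ \o _ = Re \o f)//; apply/funext => x /=; rewrite Re_conjc.
rewrite (_ : _ \o _ = -%R \o (Im \o f)); first exact: measurableT_comp.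
by apply/funext => x /=; rewrite Im_conjc.
Qed.

Lemma cmeas_restr D f : measurable D -> cmeas f -> cmeas (restr D f).
Proof.
move=> mD [a b]; split.
  rewrite (_ : _ \o _ = (Re \o f) \_ D).
    by apply/(measurable_restrictT _ mD)/measurable_funTS.
  by apply/funext => x; rewrite /restr patchE /=; case: ifP.
rewrite (_ : _ \o _ = (Im \o f) \_ D).
  by apply/(measurable_restrictT _ mD)/measurable_funTS.
by apply/funext => x; rewrite /restr patchE /=; case: ifP.
Qed.

Lemma measurable_csq f : cmeas f -> measurable_fun setT (csq \o f).
Proof. by move=> [a b]; apply: measurable_funD; exact: measurable_funX. Qed.

Lemma eq_cintegral f h : f =1 h -> cintegral setT f = cintegral setT h.
Proof. by move=> /funext ->. Qed.

Lemma cintegral_restr D f : cintegral D f = cintegral setT (restr D f).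
Proof.
rewrite /cintegral; apply: complexP => /=; rewrite [LHS]Rintegral_mkcond;
  apply: eq_Rintegral => x _; rewrite /restr patchE; by case: ifP.
Qed.

Lemma cintegralD f h : cint f -> cint h ->
  cintegral setT (fun x => f x + h x) = cintegral setT f + cintegral setT h.
Proof.
move=> [a b] [c d]; rewrite /cintegral; apply: complexP => /=.
  under eq_Rintegral do rewrite Re_add.
  by rewrite RintegralD.
under eq_Rintegral do rewrite Im_add.
by rewrite RintegralD.
Qed.

Lemma integrableZ_fin (a : R) (u : R -> R) : mu.-integrable setT (EFin \o u) ->
  mu.-integrable setT (EFin \o (fun x => a * u x)).
Proof.
move=> iu; rewrite (_ : _ \o _ = fun x => (a%:E * (EFin \o u) x)%E)//.
exact: integrableZl.
Qed.

Lemma cintZ (a : C) f : cint f -> cint (fun x => a * f x).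
Proof.
move=> [b c]; split.
  rewrite (_ : _ \o _ = ((EFin \o (fun x => Re a * Re (f x))%R) \- (EFin \o (fun x => Im a * Im (f x))%R))%E).
    by apply: integrableB => //; exact: integrableZ_fin.
  by apply/funext => x /=; rewrite Re_mul.
rewrite (_ : _ \o _ = ((EFin \o (fun x => Re a * Im (f x))%R) \+ (EFin \o (fun x => Im a * Re (f x))%R))%E).
  by apply: integrableD => //; exact: integrableZ_fin.
by apply/funext => x /=; rewrite Im_mul.
Qed.

Lemma cintegralZ (a : C) f : cint f ->
  cintegral setT (fun x => a * f x) = a * cintegral setT f.
Proof.
move=> [b c]; rewrite /cintegral; apply: complexP; rewrite ?Re_mul ?Im_mul /=.
  under eq_Rintegral do rewrite Re_mul.
  by rewrite RintegralB// ?RintegralZl//; exact: integrableZ_fin.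
under eq_Rintegral do rewrite Im_mul.
by rewrite RintegralD// ?RintegralZl//; exact: integrableZ_fin.
Qed.

Lemma cintegral_conj f : cint f ->
  cintegral setT (fun x => conjc (f x)) = conjc (cintegral setT f).
Proof.
move=> [b c]; rewrite /cintegral; apply: complexP; rewrite ?Re_conjc ?Im_conjc /=.
  by under eq_Rintegral do rewrite Re_conjc.
under eq_Rintegral do rewrite Im_conjc -mulN1r.
by rewrite RintegralZl// mulN1r.
Qed.

(** The bound compares squares, which avoids the square root of [csq]. *)
Lemma cint_le f (G : R -> R) : cmeas f -> (forall x, csq (f x) <= G x ^+ 2) ->
  (forall x, 0 <= G x) -> mu.-integrable setT (EFin \o G) -> cint f.
Proof.
move=> [a b] le G0 iG.
have key y x : y ^+ 2 <= csq (f x) -> `|y| <= G x.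
  move=> yf; rewrite -(ger0_norm (G0 x)) -ler_sqr ?nnegrE// !real_normK ?num_real//.
  exact: le_trans (le _).
split; apply: le_integrable iG => //; try exact/measurable_EFinP.
  move=> x _ /=; rewrite lee_fin [leRHS]ger0_norm//; apply: key.
  by rewrite lerDl sqr_ge0.
move=> x _ /=; rewrite lee_fin [leRHS]ger0_norm//; apply: key.
by rewrite lerDr sqr_ge0.
Qed.

Lemma aeS (P Q : R -> Prop) : (forall x, P x -> Q x) ->
  {ae mu, forall x, P x} -> {ae mu, forall x, Q x}.
Proof. by move=> PQ; apply: filterS PQ; exact: (ae_filter_ringOfSetsType mu). Qed.

Lemma aeS2 (P Q S : R -> Prop) : (forall x, P x -> Q x -> S x) ->
  {ae mu, forall x, P x} -> {ae mu, forall x, Q x} -> {ae mu, forall x, S x}.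
Proof. by move=> PQ; apply: filterS2 PQ; exact: (ae_filter_ringOfSetsType mu). Qed.

Lemma cintegral_ae f h : cint f -> cint h -> eqae f h ->
  cintegral setT f = cintegral setT h.
Proof.
move=> [a b] [c d] fh; rewrite /cintegral /Rintegral; congr (fine _ +i* fine _).
  apply: ae_eq_integral => //; try exact: measurable_int; first exact: (measurable_int _ a).
  - exact: (measurable_int _ c).
  by move: fh; apply: aeS => x /= ->.
apply: ae_eq_integral => //; first exact: (measurable_int _ b).
- exact: (measurable_int _ d).
by move: fh; apply: aeS => x /= ->.
Qed.

Lemma eqae_refl f : eqae f f.
Proof. exact: aeW. Qed.
Lemma eqae_sym f h : eqae f h -> eqae h f.
Proof. by apply: aeS => x ->. Qed.
Lemma eqae_trans f h k : eqae f h -> eqae h k -> eqae f k.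
Proof. by apply: aeS2 => x -> ->. Qed.

(** Extended-valued companion of [sqnorm]: meaningful before square-integrability is known, and the
    form to which Tonelli's theorem applies. *)
Definition esqnorm f := (\int[mu]_x (csq (f x))%:E)%E.

Lemma L2P f : L2 f <-> cmeas f /\ (esqnorm f < +oo)%E.
Proof.
have to2 (u : R -> R) : measurable_fun setT u -> (\int[mu]_x (u x ^+ 2)%:E < +oo)%E ->
    u \in Lfun mu 2%:E.
  move=> mu_ fu; rewrite inE; apply/andP; split; rewrite inE//=.
  (* The norm of [Lfun] is a power of this integral, so it is finite with it. *)
  rewrite /finite_norm unlock; apply: poweR_lty.
  apply: le_lt_trans fu; rewrite le_eqVlt; apply/orP; left; apply/eqP/eq_integral => x _ /=.
  by rewrite powR_mulrn// real_normK ?num_real.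
have m2 (u : R -> R) : u \in Lfun mu 2%:E -> measurable_fun setT u.
  by rewrite inE => /andP[/[!inE]].
split.
  move=> [a b]; split; first by split; exact: m2.
  have ia := Lfun2_integrable_sqr a; have ib := Lfun2_integrable_sqr b.
  by have := integrable_lty measurableT (integrableD measurableT ia ib).
move=> [[a b] fin]; split; apply: to2 => //.
  apply: le_lt_trans fin; apply: ge0_le_integral => //.
  - by move=> x _; rewrite lee_fin sqr_ge0.
  - by apply/measurable_EFinP; exact: measurable_funX.
  - by apply/measurable_EFinP; exact: measurable_csq.
  - by move=> x _; rewrite lee_fin lerDl sqr_ge0.
apply: le_lt_trans fin; apply: ge0_le_integral => //.
- by move=> x _; rewrite lee_fin sqr_ge0.
- by apply/measurable_EFinP; exact: measurable_funX.
- by apply/measurable_EFinP; exact: measurable_csq.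
- by move=> x _; rewrite lee_fin lerDr sqr_ge0.
Qed.

Lemma L2_cmeas f : L2 f -> cmeas f. Proof. by case/L2P. Qed.

Lemma L2_integrable f : L2 f -> mu.-integrable setT (EFin \o (csq \o f)).
Proof.
move=> /L2P[mf fin]; apply/integrableP; split.
  by apply/measurable_EFinP; exact: measurable_csq.
by under eq_integral do rewrite gee0_abs ?lee_fin ?csq_ge0//.
Qed.

Lemma L2_dom f (G : R -> R) : cmeas f -> (forall x, csq (f x) <= G x) ->
  mu.-integrable setT (EFin \o G) -> L2 f.
Proof.
move=> mf le iG; apply/L2P; split=> //.
apply: (le_lt_trans _ (integrable_lty measurableT iG)).
apply: ge0_le_integral => //.
- by move=> x _; rewrite lee_fin csq_ge0.
- by apply/measurable_EFinP; exact: measurable_csq.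
- exact: (measurable_int _ iG).
- by move=> x _; rewrite lee_fin.
Qed.

Lemma integrableD_fin (u v : R -> R) : mu.-integrable setT (EFin \o u) ->
  mu.-integrable setT (EFin \o v) -> mu.-integrable setT (EFin \o (fun x => u x + v x)).
Proof.
move=> iu iv; rewrite (_ : _ \o _ = ((EFin \o u) \+ (EFin \o v))%E)//.
exact: integrableD.
Qed.

Lemma L2D f h : L2 f -> L2 h -> L2 (fun x => f x + h x).
Proof.
move=> lf lh.
apply: (@L2_dom _ (fun x => 2 * (csq (f x) + csq (h x)))).
- by apply: cmeasD; exact: L2_cmeas.
- by move=> x; exact: csqD_le.
by apply: integrableZ_fin; apply: integrableD_fin; exact: L2_integrable.
Qed.

Lemma L2Z (a : C) f : L2 f -> L2 (fun x => a * f x).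
Proof.
move=> lf; apply: (@L2_dom _ (fun x => csq a * csq (f x))).
- by apply: cmeasM; [exact: cmeas_cst|exact: L2_cmeas].
- by move=> x; rewrite csqM.
by apply: integrableZ_fin; exact: L2_integrable.
Qed.

Lemma L2B f h : L2 f -> L2 h -> L2 (fun x => f x - h x).
Proof.
move=> lf lh; rewrite (_ : (fun _ => _) = fun x => f x + (-1) * h x).
  by apply: L2D => //; exact: L2Z.
by apply/funext => x; rewrite mulN1r.
Qed.

Lemma L2_0 : L2 (fun=> 0 : C).
Proof.
apply/L2P; split; first exact: cmeas_cst.
rewrite /esqnorm (_ : (fun _ => _) = cst 0%E) ?integral0//.
by apply/funext => x; rewrite /csq /= expr0n /= addr0.
Qed.

Lemma sumf0 (c : nat -> C) (F : nat -> R -> C) :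
  (fun x => \sum_(i < 0) c i * F i x) = (fun=> 0).
Proof. by apply/funext => x; rewrite big_ord0. Qed.

Lemma sumfS n (c : nat -> C) (F : nat -> R -> C) :
  (fun x => \sum_(i < n.+1) c i * F i x) =
  (fun x => (\sum_(i < n) c i * F i x) + c n * F n x).
Proof. by apply/funext => x; rewrite big_ord_recr. Qed.

Lemma L2_sum n (c : nat -> C) (F : nat -> R -> C) :
  (forall i, (i < n)%N -> L2 (F i)) -> L2 (fun x => \sum_(i < n) c i * F i x).
Proof.
elim: n => [_|n IH lF]; first by rewrite sumf0; exact: L2_0.
rewrite sumfS.
by apply: L2D; [apply: IH => i /ltnW /lF|apply: L2Z; exact: lF].
Qed.

Lemma L2_restr D f : measurable D -> L2 f -> L2 (restr D f).
Proof.
move=> mD lf; apply: L2_dom (L2_integrable lf).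
  by apply: cmeas_restr => //; exact: L2_cmeas.
by move=> x; rewrite /restr /=; case: ifP => // _; rewrite /csq /= expr0n addr0 csq_ge0.
Qed.

Lemma L2_cint f h : L2 f -> L2 h -> cint (fun x => f x * conjc (h x)).
Proof.
move=> lf lh.
(* With a = |f|^2 and b = |h|^2, the bound needed is ab <= (a + b)^2. *)
apply: (@cint_le _ (fun x => csq (f x) + csq (h x))).
- by apply: cmeasM; [exact: L2_cmeas|exact/cmeas_conj/L2_cmeas].
- move=> x; rewrite csqM csq_conj.
  have := csq_ge0 (f x); have := csq_ge0 (h x).
  nra.
- by move=> x; rewrite addr_ge0 ?csq_ge0.
- by apply: integrableD_fin; exact: L2_integrable.
Qed.

Lemma inner_ae f f' h h' : L2 f -> L2 f' -> L2 h -> L2 h' -> eqae f f' -> eqae h h' ->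
  inner f h = inner f' h'.
Proof.
move=> lf lf' lh lh' ff hh; apply: cintegral_ae; try exact: L2_cint.
by move: ff hh; apply: aeS2 => x -> ->.
Qed.

Lemma innerDl f h k : L2 f -> L2 h -> L2 k ->
  inner (fun x => f x + h x) k = inner f k + inner h k.
Proof.
move=> lf lh lk; rewrite /inner.
under eq_cintegral do rewrite mulrDl.
by rewrite cintegralD//; exact: L2_cint.
Qed.

Lemma innerZl (a : C) f k : L2 f -> L2 k -> inner (fun x => a * f x) k = a * inner f k.
Proof.
move=> lf lk; rewrite /inner.
under eq_cintegral do rewrite -mulrA.
by rewrite cintegralZ//; exact: L2_cint.
Qed.

Lemma inner_conj f k : L2 f -> L2 k -> inner k f = conjc (inner f k).
Proof.
move=> lf lk; rewrite /inner -cintegral_conj; last exact: L2_cint.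
apply: eq_cintegral => x; apply: complexP; rewrite !ReImE; ring.
Qed.

Lemma innerDr f h k : L2 f -> L2 h -> L2 k ->
  inner k (fun x => f x + h x) = inner k f + inner k h.
Proof.
move=> lf lh lk.
rewrite inner_conj ?innerDl//; last exact: L2D.
by rewrite (inner_conj lf)// (inner_conj lh)// rmorphD.
Qed.

Lemma innerZr (a : C) f k : L2 f -> L2 k -> inner k (fun x => a * f x) = conjc a * inner k f.
Proof.
move=> lf lk.
rewrite inner_conj ?innerZl//; last exact: L2Z.
by rewrite (inner_conj lf)// rmorphM.
Qed.

Lemma innerBl f h k : L2 f -> L2 h -> L2 k ->
  inner (fun x => f x - h x) k = inner f k - inner h k.
Proof.
move=> lf lh lk; rewrite -(mulN1r (inner h k)) -innerZl// -innerDl//; last exact: L2Z.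
by congr inner; apply/funext => x; rewrite mulN1r.
Qed.

Lemma innerBr f h k : L2 f -> L2 h -> L2 k ->
  inner k (fun x => f x - h x) = inner k f - inner k h.
Proof.
move=> lf lh lk.
rewrite inner_conj ?innerBl//; last exact: L2B.
by rewrite (inner_conj lf)// (inner_conj lh)// rmorphB.
Qed.

Lemma inner0l k : inner (fun=> 0) k = 0.
Proof.
have z (u : R -> R) : u =1 (fun=> 0) -> Rintegral mu setT u = 0.
  by move=> u0; rewrite /Rintegral integral0_eq// => x _; rewrite u0.
by apply: complexP; rewrite /= z// => x; rewrite mul0r.
Qed.

Lemma inner_suml n (c : nat -> C) (F : nat -> R -> C) k :
  (forall i, (i < n)%N -> L2 (F i)) -> L2 k ->
  inner (fun x => \sum_(i < n) c i * F i x) k = \sum_(i < n) c i * inner (F i) k.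
Proof.
move=> + lk; elim: n => [_|n IH lF]; first by rewrite sumf0 inner0l big_ord0.
have lF' i : (i < n)%N -> L2 (F i) by move=> /ltnW /lF.
have lFn := lF n (ltnSn n).
rewrite sumfS innerDl//; [|exact: L2_sum|exact: L2Z].
by rewrite IH// innerZl// big_ord_recr.
Qed.

Lemma inner_sumr n (c : nat -> C) (F : nat -> R -> C) k :
  (forall i, (i < n)%N -> L2 (F i)) -> L2 k ->
  inner k (fun x => \sum_(i < n) c i * F i x) = \sum_(i < n) conjc (c i) * inner k (F i).
Proof.
move=> lF lk; rewrite inner_conj//; last exact: L2_sum.
rewrite inner_suml// rmorph_sum; apply: eq_bigr => i _.
by have li := lF i (ltn_ord i); rewrite (inner_conj li lk) rmorphM.
Qed.

Definition sqnorm f : R := Re (inner f f).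

Lemma innerE f : L2 f -> inner f f = (sqnorm f)%:C.
Proof.
move=> lf; apply: complexP => //.
have := congr1 Im (inner_conj lf lf); rewrite Im_conjc [Im (_ %:C)]/=; lra.
Qed.

Lemma sqnormE f : L2 f -> (sqnorm f)%:E = esqnorm f.
Proof.
move=> lf; have fi : esqnorm f \is a fin_num by exact: integrable_fin_num (L2_integrable lf).
rewrite -(fineK fi); congr (fine _)%:E.
by apply: eq_integral => x _; rewrite csqE.
Qed.

Lemma sqnorm_ge0 f : L2 f -> 0 <= sqnorm f.
Proof.
by move=> lf; rewrite -lee_fin sqnormE//; apply: integral_ge0 => x _; rewrite lee_fin csq_ge0.
Qed.

Lemma sqnorm_eq0 f : L2 f -> sqnorm f = 0 -> eqae f (fun=> 0).
Proof.
move=> lf f0.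
have e : esqnorm f = (\int[mu]_x `|(EFin \o (csq \o f)) x|)%E.
  by apply: eq_integral => x _; rewrite gee0_abs// lee_fin csq_ge0.
have mf := measurable_int _ (L2_integrable lf).
have := sqnormE lf; rewrite f0 e => /esym.
move=> /(ae_eq_integral_abs mu measurableT mf).
by apply: aeS => x /= /(_ I) [] /csq_eq0.
Qed.

Lemma norm2E f : norm2 f = Num.sqrt (sqnorm f). Proof. by []. Qed.

Lemma norm2_csq f : L2 f -> norm2 f ^+ 2 = sqnorm f.
Proof. by move=> lf; rewrite norm2E sqr_sqrtr// sqnorm_ge0. Qed.

Lemma sqnorm_ae f h : L2 f -> L2 h -> eqae f h -> sqnorm f = sqnorm h.
Proof. by move=> lf lh fh; rewrite /sqnorm (inner_ae lf lh lf lh). Qed.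

Lemma sqnorm_le f h : L2 f -> L2 h -> (forall x, csq (f x) <= csq (h x)) -> sqnorm f <= sqnorm h.
Proof.
move=> lf lh fh; rewrite -lee_fin !sqnormE//; apply: ge0_le_integral => //.
- by move=> x _; rewrite lee_fin csq_ge0.
- exact: (measurable_int _ (L2_integrable lf)).
- exact: (measurable_int _ (L2_integrable lh)).
- by move=> x _; rewrite lee_fin.
Qed.

Lemma sqnormD f h : L2 f -> L2 h ->
  sqnorm (fun x => f x + h x) = sqnorm f + sqnorm h + 2 * Re (inner f h).
Proof.
move=> lf lh; rewrite /sqnorm innerDl ?innerDr//; last exact: L2D.
by rewrite (inner_conj lf lh) !ReImE; ring.
Qed.

Lemma sqnormB f h : L2 f -> L2 h ->
  sqnorm (fun x => f x - h x) = sqnorm f + sqnorm h - 2 * Re (inner f h).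
Proof.
move=> lf lh; rewrite /sqnorm innerBl ?innerBr//; last exact: L2B.
by rewrite (inner_conj lf lh) !ReImE; ring.
Qed.

Lemma sqnormZ a f : L2 f -> sqnorm (fun x => a * f x) = csq a * sqnorm f.
Proof.
move=> lf; rewrite /sqnorm innerZl ?innerZr//; last exact: L2Z.
by rewrite (innerE lf) mulrA csqE !ReImE /=; ring.
Qed.

(** Parallelogram law, with the norm of the difference dropped. *)
Lemma sqnormD_le f h : L2 f -> L2 h -> sqnorm (fun x => f x + h x) <= 2 * (sqnorm f + sqnorm h).
Proof.
move=> lf lh; have := sqnorm_ge0 (L2B lf lh); rewrite sqnormB// sqnormD//; lra.
Qed.

Lemma sqnormB_le f h : L2 f -> L2 h -> sqnorm (fun x => f x - h x) <= 2 * (sqnorm f + sqnorm h).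
Proof.
move=> lf lh; have := sqnorm_ge0 (L2D lf lh); rewrite sqnormB// sqnormD//; lra.
Qed.

End Integrals.
Arguments L2_0 {R}.

(** * Completeness of L^2 *)

Section RieszFischer.
Context d (T : measurableType d) (R : realType) (mu : {measure set T -> \bar R}).
Local Open Scope ereal_scope.

Lemma limn_einf_le (u : (\bar R)^nat) (c : \bar R) (N : nat) :
  (forall n, (N <= n)%N -> u n <= c) -> limn_einf u <= c.
Proof.
move=> uc; rewrite limn_einf_lim; apply: lime_le; first exact: is_cvg_einfs.
apply: nearW => k; apply: (@le_trans _ _ (u (maxn N k))); last first.
  by apply: uc; rewrite leq_maxl.
by apply: ereal_inf_lbound; exists (maxn N k) => //=; rewrite leq_maxr.
Qed.

(** A fast subsequence has increments [dl j] for which the sum [G] of the 4^j |dl j|^2 is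
    integrable. Where [G] is finite, |dl j| <= sqrt G / 2^j, so the subsequence converges almost
    everywhere; Fatou's lemma then bounds the distance of the whole sequence to the limit. *)
Lemma riesz_fischer_real (s : nat -> T -> R) :
  (forall n, measurable_fun setT (s n)) ->
  (forall e : R, (0 < e)%R -> exists N, forall m n, (N <= m)%N -> (N <= n)%N ->
    \int[mu]_x ((s m x - s n x) ^+ 2)%:E <= e%:E) ->
  exists2 u : T -> R, measurable_fun setT u &
  forall e : R, (0 < e)%R -> exists N, forall n, (N <= n)%N ->
    \int[mu]_x ((s n x - u x) ^+ 2)%:E <= e%:E.
Proof.
move=> ms cs.
(* With this choice 4^j eps_j = 2^-(j+1), and these sum to 1. *)
pose eps j : R := (1 / (2 ^ j.+1)%:R / 4 ^+ j)%R.
have eps0 j : (0 < eps j)%R by rewrite /eps !divr_gt0// ?exprn_gt0// ltr0n expn_gt0.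
have [nu nuP] := choice (fun j => cs (eps j) (eps0 j)).
(* The sum makes the indices nondecreasing and at least [nu j]; the term [j] makes them tend to
   infinity. *)
pose n_ j := (j + \sum_(i < j.+1) nu i)%N.
have n_S j : (n_ j <= n_ j.+1)%N by rewrite /n_ [X in (_ <= _ + X)%N]big_ord_recr/= leq_add ?leq_addr.
have n_nu j : (nu j <= n_ j)%N by rewrite /n_ big_ord_recr/= addnA leq_addl.
pose dl j x : R := (s (n_ j.+1) x - s (n_ j) x)%R.
pose G_ j x : \bar R := (4 ^+ j * dl j x ^+ 2)%:E.
pose G x := \sum_(0 <= j <oo) G_ j x.
have mdl j : measurable_fun setT (dl j) by exact: measurable_funB.
have mG_ j : measurable_fun setT (G_ j).
  by apply/measurable_EFinP/measurable_funM => //; exact: measurable_funX.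
have G_0 j x : 0 <= G_ j x by rewrite lee_fin; apply: mulr_ge0; [exact: exprn_ge0|exact: sqr_ge0].
have mG : measurable_fun setT G.
  exact: (ge0_emeasurable_sum (P := xpredT)).
have intG : \int[mu]_x G x <= 1.
  rewrite integral_nneseries//; apply: le_trans (epsilon_trick0 xpredT ler01).
  apply: lee_nneseries => // [i _ _|i _]; first exact: integral_ge0.
  under eq_integral do rewrite /G_ EFinM.
  rewrite ge0_integralZl//; last 2 first.
  - by apply/measurable_EFinP; exact: measurable_funX.
  - by move=> x _; rewrite lee_fin sqr_ge0.
  have -> : (1 / (2 ^ i.+1)%:R)%:E = (4 ^+ i)%:E * (eps i)%:E.
    by rewrite -EFinM /eps mulrCA divff ?mulr1// expf_neq0.
  rewrite lee_pmul2l ?lte_fin ?exprn_gt0//.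
  by apply: nuP => //; exact: leq_trans (n_S _).
have iG : mu.-integrable setT G.
  apply/integrableP; split=> //.
  under eq_integral do rewrite gee0_abs ?nneseries_ge0//.
  by rewrite (le_lt_trans intG)// ltry.
(* An upper limit is measurable before any convergence is known; [fine] makes it real where it is
   infinite. *)
pose u x : R := fine (limn_esup (fun j => (s (n_ j) x)%:E)).
have mu_ : measurable_fun setT u.
  apply: measurableT_comp; first exact: fine_measurable.
  by apply: measurable_fun_limn_esup => j; exact/measurable_EFinP.
have cvgu x : G x \is a fin_num -> (s (n_ j) x @[j --> \oo] --> u x)%R.
  move=> Gx; set g := fine (G x).
  have dg j : (`|dl j x| <= (geometric (Num.sqrt g) (2^-1)) j)%R.
    have : G_ j x <= G x.
      have := @nneseries_lim_ge R (G_^~ x) xpredT 0 j.+1 (fun n _ _ => G_0 n x).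
      apply: le_trans; rewrite big_nat_recr//= leeDr// sume_ge0//.
    move=> dG; have dg : (4 ^+ j * dl j x ^+ 2 <= g)%R by rewrite -lee_fin /g fineK.
    have g0 : (0 <= g)%R by rewrite fine_ge0// nneseries_ge0.
    rewrite /geometric/= -ler_sqr ?nnegrE ?mulr_ge0 ?sqrtr_ge0 ?exprn_ge0 ?invr_ge0//.
    rewrite real_normK ?num_real// exprMn sqr_sqrtr// exprVn exprVn.
    have e4 : (4 ^+ j = (2 ^+ j) ^+ 2 :> R)%R by rewrite -exprM mulnC exprM expr2 -natrM.
    by rewrite ler_pdivlMr ?exprn_gt0// mulrC -e4.
  have : cvgn (series (dl^~ x)).
    apply: normed_cvg; apply: (@series_le_cvg _ _ (geometric (Num.sqrt g) (2^-1))) => //.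
    - by move=> j; exact: normr_ge0.
    - by move=> j; rewrite /geometric/=; apply: mulr_ge0; rewrite ?sqrtr_ge0 ?exprn_ge0 ?invr_ge0.
    - by apply: is_cvg_geometric_series; rewrite ger0_norm// invf_lt1// ltr1n.
  move=> /cvg_ex[l sl].
  have sE : (fun j => s (n_ j) x) = (fun j => (s (n_ 0%N) x + series (dl^~ x) j)%R).
    apply/funext => j; rewrite (eq_sum_telescope (fun j => s (n_ j) x) j).
    by [].
  have c1 : (s (n_ j) x @[j --> \oo] --> (s (n_ 0%N) x + l)%R)%R.
    by rewrite sE; apply: cvgD => //; exact: cvg_cst.
  have /cvg_limn_einf_sup[_ e] : (s (n_ j) x)%:E @[j --> \oo] --> (s (n_ 0%N) x + l)%:E.
    by apply: cvg_EFin => //; exact: nearW.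
  by rewrite /u e.
exists u => // e e0.
have [N NP] := cs _ e0; exists N => n Nn.
pose F j x : \bar R := ((s n x - s (n_ j) x) ^+ 2)%:E.
have mF j : measurable_fun setT (F j).
  by apply/measurable_EFinP/measurable_funX/measurable_funB.
have F0 j x : setT x -> 0 <= F j x by rewrite lee_fin sqr_ge0.
have fat := fatou mu measurableT mF F0.
have -> : \int[mu]_x ((s n x - u x) ^+ 2)%:E = \int[mu]_x limn_einf (F^~ x).
  apply: ae_eq_integral => //.
  - by apply/measurable_EFinP/measurable_funX/measurable_funB.
  - rewrite (_ : (fun x => _) = fun x => - limn_esup (fun j => - F j x)).
      apply: measurableT_comp => //; apply: measurable_fun_limn_esup => j.
      exact: measurableT_comp.
    by [].
  have := integrable_ae measurableT iG; apply: filterS => x /(_ I) /cvgu c _.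
  have /cvg_limn_einf_sup[-> _]// : F j x @[j --> \oo] --> ((s n x - u x) ^+ 2)%:E.
  apply: cvg_EFin; first exact: nearW.
  by apply: cvgM; apply: cvgB => //; exact: cvg_cst.
apply: (le_trans fat).
have [J NJ] : exists J, forall j, (J <= j)%N -> (N <= n_ j)%N.
  by exists N => j /leq_trans; apply; exact: leq_addr.
apply: (@limn_einf_le _ _ J) => j /NJ Nj.
exact: NP.
Qed.

End RieszFischer.

(** * Orthonormal systems: Bessel, Cauchy-Schwarz, Riesz-Fischer *)

Section Hilbert.
Variable R : realType.
Notation C := R[i].
Notation Re := (@complex.Re R).
Notation Im := (@complex.Im R).
Notation mu := (@lebesgue_measure R).
Implicit Types (f h : R -> C) (D : set R).

Lemma Re_sum (I : Type) (r : seq I) (P : pred I) (z : I -> C) :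
  Re (\sum_(i <- r | P i) z i) = \sum_(i <- r | P i) Re (z i).
Proof. by elim/big_rec2 : _ => // i a b _ <-; rewrite Re_add. Qed.

Lemma L2_complete (s : nat -> R -> C) : (forall n, L2 (s n)) ->
  (forall e, 0 < e -> exists N, forall m n, (N <= m)%N -> (N <= n)%N ->
    sqnorm (fun x => s m x - s n x) <= e) ->
  exists2 u, L2 u & forall e, 0 < e -> exists N, forall n, (N <= n)%N ->
    sqnorm (fun x => s n x - u x) <= e.
Proof.
move=> ls cs.
have split_le m n (e : R) : sqnorm (fun x => s m x - s n x) <= e ->
  (\int[mu]_x ((Re (s m x) - Re (s n x)) ^+ 2)%:E <= e%:E)%E /\
  (\int[mu]_x ((Im (s m x) - Im (s n x)) ^+ 2)%:E <= e%:E)%E.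
  have lB := L2B (ls m) (ls n).
  rewrite -lee_fin sqnormE// => le.
  have [mR mI] := L2_cmeas lB.
  have msq := measurable_int _ (L2_integrable lB).
  split; apply: (le_trans _ le).
    apply: ge0_le_integral => //.
    - by move=> x _; rewrite lee_fin sqr_ge0.
    - apply/measurable_EFinP/measurable_funX; apply: measurable_funB.
        exact: (L2_cmeas (ls m)).1.
      exact: (L2_cmeas (ls n)).1.
    - by move=> x _; rewrite lee_fin /csq !ReImE lerDl sqr_ge0.
  apply: ge0_le_integral => //.
  - by move=> x _; rewrite lee_fin sqr_ge0.
  - apply/measurable_EFinP/measurable_funX; apply: measurable_funB.
      exact: (L2_cmeas (ls m)).2.
    exact: (L2_cmeas (ls n)).2.
  - by move=> x _; rewrite lee_fin /csq !ReImE lerDr sqr_ge0.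
have [|e e0|a ma aP] := @riesz_fischer_real _ _ R mu (fun n x => Re (s n x)).
- by move=> n; exact: (L2_cmeas (ls n)).1.
- by have [N NP] := cs e e0; exists N => m n Nm Nn; exact: (split_le _ _ _ (NP _ _ Nm Nn)).1.
have [|e e0|b mb bP] := @riesz_fischer_real _ _ R mu (fun n x => Im (s n x)).
- by move=> n; exact: (L2_cmeas (ls n)).2.
- by have [N NP] := cs e e0; exists N => m n Nm Nn; exact: (split_le _ _ _ (NP _ _ Nm Nn)).2.
pose u x : C := a x +i* b x.
have mu_ : cmeas u by split.
have esqnormu e : 0 < e -> exists N, forall n, (N <= n)%N ->
    (esqnorm (fun x => (s n x - u x)%R) <= e%:E)%E.
  move=> e0; have e20 : 0 < e / 2 by rewrite divr_gt0.
  have [Na aN] := aP _ e20; have [Nb bN] := bP _ e20.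
  exists (maxn Na Nb) => n; rewrite geq_max => /andP[/aN an /bN bn].
  rewrite [leRHS](_ : _ = ((e / 2)%:E + (e / 2)%:E)%E); last first.
    by rewrite -EFinD -splitr.
  apply: le_trans (leeD an bn); rewrite -ge0_integralD//; last 4 first.
  - by move=> x _; rewrite lee_fin sqr_ge0.
  - apply/measurable_EFinP/measurable_funX; apply: measurable_funB => //.
    exact: (L2_cmeas (ls n)).1.
  - by move=> x _; rewrite lee_fin sqr_ge0.
  - apply/measurable_EFinP/measurable_funX; apply: measurable_funB => //.
    exact: (L2_cmeas (ls n)).2.
  rewrite le_eqVlt; apply/orP; left; apply/eqP; apply: eq_integral => x _.
  by rewrite /csq !ReImE EFinD.
have msu n : cmeas (fun x => s n x - u x).
  rewrite (_ : (fun _ => _) = fun x => s n x + (-1) * u x).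
    apply: cmeasD; first exact: L2_cmeas.
    by apply: cmeasM => //; exact: cmeas_cst.
  by apply/funext => x; rewrite mulN1r.
have lu : L2 u.
  have [N /(_ N (leqnn _)) le1] := esqnormu 1 ltr01.
  have lsu : L2 (fun x => s N x - u x) by apply/L2P; split => //; exact: le_lt_trans le1 (ltry _).
  rewrite (_ : u = fun x => s N x - (s N x - u x)); first exact: L2B.
  by apply/funext => x; rewrite opprB addrC subrK.
exists u => // e /esqnormu[N NP]; exists N => n /NP.
by rewrite -sqnormE ?lee_fin//; exact: L2B.
Qed.

(* An orthonormal system indexed by [J], extended by vectors of norm zero
   outside of [J]. *)
Definition orthosys (J : pred nat) (e : nat -> R -> C) :=
  (forall k, L2 (e k)) /\ forall k l, inner (e k) (e l) = ((k == l) && J k)%:R.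

Lemma orthonormal_sys (J : pred nat) (e : nat -> R -> C) : Defs.orthonormal J e ->
  orthosys J (fun k => if J k then e k else (fun=> 0)).
Proof.
move=> [le ee]; split.
  by move=> k; case: ifP => [|_]; [exact: le|exact: L2_0].
move=> k l; case: ifPn => Jk; last by rewrite inner0l andbF.
rewrite andbT; case: ifPn => Jl; first exact: ee.
rewrite (inner_conj L2_0 (le _ Jk)) inner0l conjc0.
by case: eqP => // kl; move: Jl; rewrite -kl Jk.
Qed.

Lemma sqnorm_comb J e n (c : nat -> C) : orthosys J e ->
  sqnorm (fun x => \sum_(k < n) c k * e k x) = \sum_(k < n | J k) csq (c k).
Proof.
move=> [le ee]; have ls := L2_sum c (fun k (_ : (k < n)%N) => le k).
rewrite /sqnorm inner_suml// Re_sum [RHS]big_mkcond /=; apply: eq_bigr => k _.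
rewrite inner_sumr// (bigD1 k)//= big1 ?addr0; last first.
  move=> l lk; have kl : (k == l :> nat) = false by rewrite eq_sym; exact: negbTE.
  by rewrite ee kl mulr0.
rewrite ee eqxx /=; case: (J k); last by rewrite !mulr0.
by rewrite mulr1 csqE.
Qed.

Lemma sqnorm_comb_le J e n (c : nat -> C) : orthosys J e ->
  sqnorm (fun x => \sum_(k < n) c k * e k x) <= \sum_(k < n) csq (c k).
Proof.
move=> oe; rewrite (sqnorm_comb _ _ oe) big_mkcond /=; apply: ler_sum => k _.
by case: ifP => // _; exact: csq_ge0.
Qed.

(** Pythagoras, as an inequality: the coefficients at the null vectors outside [J] are bounded by
    their squares instead of being evaluated. *)
Lemma sqnorm_proj J e n f : orthosys J e -> L2 f ->
  sqnorm (fun x => f x - \sum_(k < n) inner f (e k) * e k x) <=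
    sqnorm f - \sum_(k < n) csq (inner f (e k)).
Proof.
move=> oe lf; have [le ee] := oe.
pose c k := inner f (e k).
have ls := L2_sum c (fun k (_ : (k < n)%N) => le k).
rewrite sqnormB// (inner_sumr c (fun k (_ : (k < n)%N) => le k) lf) Re_sum.
have -> : \sum_(i < n) Re (conjc (c i) * inner f (e i)) = \sum_(i < n) csq (c i).
  by apply: eq_bigr => i _; rewrite mulrC csqE.
have := sqnorm_comb_le n c oe; rewrite -/c; lra.
Qed.

Lemma bessel J e n f : orthosys J e -> L2 f ->
  \sum_(k < n) csq (inner f (e k)) <= sqnorm f.
Proof.
move=> oe lf; have := sqnorm_proj n oe lf.
have ls := L2_sum (fun k => inner f (e k)) (fun k (_ : (k < n)%N) => oe.1 k).
have := sqnorm_ge0 (L2B lf ls); lra.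
Qed.

Lemma cauchy_schwarz f h : L2 f -> L2 h -> csq (inner f h) <= sqnorm f * sqnorm h.
Proof.
move=> lf lh.
have [h0|h0] := eqVneq (sqnorm h) 0.
  rewrite h0 mulr0 (inner_ae lf lf lh L2_0 (eqae_refl f) (sqnorm_eq0 lh h0)).
  by rewrite (inner_conj L2_0 lf) inner0l conjc0 /csq /= expr0n addr0.
have hp : 0 < sqnorm h by rewrite lt_neqAle eq_sym h0 sqnorm_ge0.
(* [c * h] is the projection of [f] on the line of [h]. *)
pose c : C := inner f h * ((sqnorm h)^-1)%:C.
have := sqnorm_ge0 (L2B lf (L2Z c lh)).
rewrite sqnormB//; last exact: L2Z.
rewrite sqnormZ// innerZr//.
have -> : Re (conjc c * inner f h) = (sqnorm h)^-1 * csq (inner f h).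
  by rewrite /c /csq !ReImE /=; ring.
have -> : csq c * sqnorm h = (sqnorm h)^-1 * csq (inner f h).
  by rewrite /c csqM [csq _%:C]/csq /= expr0n addr0; field.
move=> le; rewrite -ler_pdivrMr// mulrC; lra.
Qed.

(** The squared norm of a block of the series is at most an increment of the sums [S] of squared
    coefficients, and [S] converges, being nondecreasing and bounded. *)
Lemma riesz_fischer J e (c : nat -> C) (B : R) : orthosys J e ->
  (forall n, \sum_(k < n) csq (c k) <= B) ->
  exists2 u, L2 u & forall eps, 0 < eps -> exists N, forall n, (N <= n)%N ->
    sqnorm (fun x => (\sum_(k < n) c k * e k x) - u x) <= eps.
Proof.
move=> oe cB; have [le ee] := oe.
pose S n := \sum_(k < n) csq (c k).
have ls n := L2_sum c (fun k (_ : (k < n)%N) => le k).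
have dS m n : (m <= n)%N ->
    sqnorm (fun x => (\sum_(k < n) c k * e k x) - (\sum_(k < m) c k * e k x)) <= S n - S m.
  move=> mn.
  pose c' k := if (m <= k)%N then c k else 0.
  have E (V : nmodType) (F : nat -> V) :
      \sum_(k < n) F k = \sum_(k < m) F k + \sum_(k < n) (if (m <= k)%N then F k else 0).
    rewrite (big_ord_widen n F mn) [in RHS]big_mkcond -big_split /=.
    by apply: eq_bigr => k _; case: ltnP; rewrite ?addr0 ?add0r.
  rewrite (_ : (fun _ => _) = fun x => \sum_(k < n) c' k * e k x).
    apply: le_trans (sqnorm_comb_le n c' oe) _.
    rewrite /S (E _ (fun k => csq (c k))) addrC addKr.
    apply: ler_sum => k _; rewrite /c'; case: ifP => // _.
    by rewrite /csq /= expr0n addr0.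
  apply/funext => x; rewrite (E _ (fun k => c k * e k x)) addrC addKr.
  by apply: eq_bigr => k _; rewrite /c'; case: ifP => // _; rewrite mul0r.
apply: L2_complete => // eps eps0.
have Snd : nondecreasing_seq S.
  by apply/nondecreasing_seqP => n; rewrite /S big_ord_recr/= lerDl csq_ge0.
have cS : cvgn S.
  by apply: nondecreasing_is_cvgn => //; exists B => _ [n _ <-]; exact: cB.
have := cS; move=> /cvgrPdist_le /(_ _ eps0)[N _ NP].
have key m n : (N <= m)%N -> (m <= n)%N -> S n - S m <= eps.
  move=> Nm mn.
  have SnL : S n <= limn S by exact: nondecreasing_cvgn_le.
  by have := NP m Nm => /=; move: SnL; rewrite ler_norml => ? /andP[_]; lra.
exists N => m n Nm Nn; have [mn|/ltnW nm] := leqP m n.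
  rewrite (_ : sqnorm _ = sqnorm (fun x => (\sum_(k < n) c k * e k x) - (\sum_(k < m) c k * e k x))).
    exact: le_trans (dS _ _ mn) (key _ _ Nm mn).
  by rewrite !sqnormB// (inner_conj (ls n) (ls m)) Re_conjc; ring.
exact: le_trans (dS _ _ nm) (key _ _ Nn nm).
Qed.

End Hilbert.

(** * Translations and reflections *)

Section MeasurePreserving.
Variable R : realType.
Notation C := R[i].
Notation Re := (@complex.Re R).
Notation Im := (@complex.Im R).
Notation mu := (@lebesgue_measure R).
Notation RT := (measurableTypeR R).
Implicit Types (f h : R -> C) (D : set R).

(** Covers both the translations and the reflection s -> x - s inside a convolution. *)
Definition preserving (phi : RT -> RT) :=
  measurable_fun setT phi /\ forall A : set RT, measurable A -> mu (phi @^-1` A) = mu A.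

Lemma preserving_addr (t : R) : preserving (fun x : R => x + t).
Proof.
have m : measurable_fun setT ((fun x : R => x + t) : RT -> RT) by exact: measurable_funD.
split=> // A mA.
rewrite -[LHS]/(pushforward mu ((fun x : R => x + t) : RT -> RT) A).
apply/esym/lebesgue_measure_unique => //= _ [[a b]] _ <-.
rewrite /pushforward (_ : _ @^-1` _ = `]a - t, b - t]%classic); last first.
  by apply/seteqP; split => x /=; rewrite !in_itv/= ltrBlDr lerBrDr.
rewrite !lebesgue_measure_itv/= !lte_fin ltrD2r; case: ifP => // _.
by rewrite -!EFinB; congr EFin; ring.
Qed.

Lemma preserving_oppr : preserving (fun x : R => - x).
Proof.
split; last exact: lebesgue_measureN.
exact: oppr_measurable.
Qed.

Lemma preserving_comp phi psi : preserving phi -> preserving psi -> preserving (phi \o psi).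
Proof.
move=> [mp pp] [ms ps]; split; first exact: measurableT_comp.
move=> A mA; rewrite comp_preimage ps ?pp//.
by rewrite -[X in measurable X]setTI; exact: mp.
Qed.

Lemma preserving_subr (c : R) : preserving (fun x : R => c - x).
Proof.
rewrite (_ : (fun _ => _) = (fun x : R => x + c) \o (fun x : R => - x)).
  exact: preserving_comp (preserving_addr c) preserving_oppr.
by apply/funext => x /=; rewrite addrC.
Qed.

Section phi.
Variables (phi : RT -> RT) (pphi : preserving phi).

Lemma ge0_integral_preserving (u : R -> \bar R) :
  measurable_fun setT (u : RT -> \bar R) -> (forall x, 0 <= u x)%E ->
  (\int[mu]_x u (phi x) = \int[mu]_x u x)%E.
Proof.
move=> m u0; have [mp pp] := pphi.
transitivity (\int[pushforward mu phi]_(y in setT) u y)%E.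
  by rewrite ge0_integral_pushforward//.
by apply: eq_measure_integral => A mA _; exact: pp.
Qed.

Lemma integrable_preserving (u : R -> R) :
  mu.-integrable setT (EFin \o u) -> mu.-integrable setT (EFin \o (u \o phi)).
Proof.
move=> iu; have [mp pp] := pphi; apply/integrableP; split.
  rewrite (_ : EFin \o _ = (EFin \o u) \o phi)//; apply: measurableT_comp => //.
  exact: measurable_int iu.
rewrite (ge0_integral_preserving (u := fun x => `|(u x)%:E|%E))//.
  by case/integrableP: iu.
by apply: measurableT_comp => //; exact: measurable_int iu.
Qed.

Lemma Rintegral_preserving (u : R -> R) : mu.-integrable setT (EFin \o u) ->
  Rintegral mu setT (u \o phi) = Rintegral mu setT u.
Proof.
move=> iu; have [mp pp] := pphi; rewrite /Rintegral; congr fine.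
transitivity (\int[pushforward mu phi]_(y in setT) (u y)%:E)%E.
  rewrite integral_pushforward//.
  - exact: measurable_int iu.
  - exact: integrable_preserving.
by apply: eq_measure_integral => A mA _; exact: pp.
Qed.

Lemma ae_preserving (P : R -> Prop) :
  {ae mu, forall x, P x} -> {ae mu, forall x, P (phi x)}.
Proof.
have [mp pp] := pphi => -[N [mN N0 PN]]; exists (phi @^-1` N); split.
- by rewrite -[X in measurable X]setTI; exact: mp.
- by rewrite pp.
- by move=> x /= nP; exact: PN.
Qed.

Lemma L2_preserving f : L2 f -> L2 (f \o phi).
Proof.
have [mp pp] := pphi => /L2P[[a b] fin]; apply/L2P; split.
  by split; [exact: (measurableT_comp a)|exact: (measurableT_comp b)].
rewrite /esqnorm (ge0_integral_preserving (u := fun x => (csq (f x))%:E))//.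
  by apply/measurable_EFinP; exact: measurable_csq.
by move=> x; rewrite lee_fin csq_ge0.
Qed.

Lemma cintegral_preserving f : cint f -> cintegral setT (f \o phi) = cintegral setT f.
Proof.
move=> [a b]; apply: complexP; rewrite /=.
  exact: (Rintegral_preserving a).
exact: (Rintegral_preserving b).
Qed.

Lemma inner_preserving f h : L2 f -> L2 h -> inner (f \o phi) (h \o phi) = inner f h.
Proof. by move=> lf lh; rewrite /inner -(cintegral_preserving (L2_cint lf lh)). Qed.

End phi.

Lemma L2_tshift t f : L2 f -> L2 (tshift t f).
Proof. exact: (L2_preserving (preserving_addr t)). Qed.

Lemma inner_tshift t f h : L2 f -> L2 h -> inner (tshift t f) (tshift t h) = inner f h.
Proof. exact: (inner_preserving (preserving_addr t)). Qed.

Lemma sqnorm_tshift t f : L2 f -> sqnorm (tshift t f) = sqnorm f.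
Proof. by move=> lf; rewrite /sqnorm inner_tshift. Qed.

Lemma ae_tshift t (P : R -> Prop) :
  {ae mu, forall x, P x} -> {ae mu, forall x, P (x + t)}.
Proof. exact: (ae_preserving (preserving_addr t)). Qed.

Lemma tshiftK t f : tshift (- t) (tshift t f) = f.
Proof. by apply/funext => x; rewrite /tshift subrK. Qed.

Lemma inner_tshiftl t f h : L2 f -> L2 h ->
  inner (tshift t f) h = inner f (tshift (- t) h).
Proof.
move=> lf lh; rewrite -(inner_tshift (- t)) ?tshiftK//; exact: L2_tshift.
Qed.

End MeasurePreserving.

(** * Laplace transforms of exponentials *)

Section Exponentials.
Variable R : realType.
Notation C := R[i].
Notation Re := (@complex.Re R).
Notation Im := (@complex.Im R).
Notation mu := (@lebesgue_measure R).
Implicit Types (f h : R -> C) (D : set R) (a b p q K x t : R).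

(** A family closed under differentiation, hence also under antidifferentiation when [a] and [b] are
    not both 0. *)
Definition expcs (a b p q x : R) : R := expR (a * x) * (p * cos (b * x) + q * sin (b * x)).

Lemma is_derive_expcs (a b p q x : R) :
  is_derive x (1:R) (expcs a b p q) (expcs a b (a * p + b * q) (a * q - b * p) x).
Proof.
have d1 (c : R) : is_derive x (1:R) (fun x => c * x) c.
  rewrite (_ : (fun x => _) = c \*: id); last by [].
  by apply: is_derive_eq; rewrite /GRing.scale /= mulr1.
have de : is_derive x (1:R) (fun x => expR (a * x)) (expR (a * x) * a).
  exact: (@is_derive1_comp _ expR (fun x => a * x)).
have dc : is_derive x (1:R) (fun x => cos (b * x)) (- sin (b * x) * b).
  exact: (@is_derive1_comp _ cos (fun x => b * x)).
have ds : is_derive x (1:R) (fun x => sin (b * x)) (cos (b * x) * b).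
  exact: (@is_derive1_comp _ sin (fun x => b * x)).
rewrite (_ : expcs a b p q = (fun x => expR (a * x)) *
  (p \*: (fun x => cos (b * x)) + q \*: (fun x => sin (b * x)))); last by [].
apply: is_derive_eq.
by rewrite !fctE /expcs /GRing.scale /= /GRing.scale /=; ring.
Qed.

Lemma continuous_expcs a b p q : continuous (expcs a b p q).
Proof.
move=> x; apply/differentiable_continuous/derivable1_diffP.
by have [] := is_derive_expcs a b p q x.
Qed.

Lemma abs_expcs a b p q x : `|expcs a b p q x| <= (`|p| + `|q|) * expR (a * x).
Proof.
rewrite /expcs normrM gtr0_norm ?expR_gt0// mulrC ler_pM2r ?expR_gt0//.
apply: (le_trans (ler_normD _ _)); rewrite !normrM.
apply: lerD; rewrite -[leRHS]mulr1 ler_pM ?normr_ge0//; rewrite ler_norml.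
  by rewrite cos_geN1 cos_le1.
by rewrite sin_geN1 sin_le1.
Qed.

Lemma cvg_expR_ninfty a : a < 0 -> expR (a * x) @[x --> +oo] --> (0:R).
Proof.
move=> a0; have h := @cvgr_expR R.
rewrite (_ : (fun x => expR (a * x)) = (fun x => expR (- x)) \o (fun x => x * (- a))).
  apply: cvg_comp h; apply: gt0_cvgMly; first by rewrite oppr_gt0.
  exact: cvg_id.
by apply/funext => x /=; rewrite mulrN opprK mulrC.
Qed.

Lemma cvg_expcs a b p q : a < 0 -> expcs a b p q x @[x --> +oo] --> (0:R).
Proof.
move=> a0.
have K0 : (`|p| + `|q|) * expR (a * x) @[x --> +oo] --> (0:R).
  by rewrite -[X in _ --> X](mulr0 (`|p| + `|q|)); apply: cvgMr; exact: cvg_expR_ninfty.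
apply/norm_cvg0P; apply: (squeeze_cvgr _ (cvg_cst 0) K0); apply: nearW => x.
by rewrite normr_ge0 abs_expcs.
Qed.

(** The fundamental theorem on a half-line is applied to a nonnegative integrand; the term
    [K * expR (a * x)] is added to make it so, and subtracted again in [integral_expcs]. *)
Lemma integral_expcs_ge0 a b p q K : a < 0 ->
  `|a * p + b * q| + `|a * q - b * p| <= K ->
  (\int[mu]_(x in `[0%R, +oo[) (expcs a b (a * p + b * q) (a * q - b * p) x +
       K * expR (a * x))%:E = (- (p + K / a))%:E)%E.
Proof.
move=> a0 Kge.
pose F x := expcs a b p q x + expcs a 0 (K / a) 0 x.
have dF x : is_derive x (1:R) F (expcs a b (a * p + b * q) (a * q - b * p) x +
       K * expR (a * x)).
  have d1 := is_derive_expcs a b p q x; have d2 := is_derive_expcs a 0 (K / a) 0 x.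
  rewrite (_ : F = expcs a b p q + expcs a 0 (K / a) 0); last by [].
  apply: is_derive_eq; congr (_ + _); rewrite /expcs !mul0r cos0 ?sin0.
  by field; rewrite lt_eqF.
have cF x : {for x, continuous F}.
  apply/differentiable_continuous/derivable1_diffP.
  by have [] := dF x.
rewrite (@ge0_continuous_FTC2y _ _ F 0 0).
- by rewrite -EFinB /F /expcs !mulr0 !mul0r expR0 cos0 ?sin0; congr EFin; ring.
- move=> x _; have := abs_expcs a b (a * p + b * q) (a * q - b * p) x.
  rewrite ler_norml => /andP[+ _]; have := expR_gt0 (a * x); nra.
- apply: continuous_subspaceT => x; apply: cvgD; first exact: continuous_expcs.
  have := @continuous_expcs a 0 K 0 x; rewrite (_ : expcs a 0 K 0 = fun x => K * expR (a * x))//.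
  by apply/funext => y; rewrite /expcs !mul0r cos0 ?sin0; ring.
- rewrite -[X in _ --> X](addr0 0); apply: cvgD; exact: cvg_expcs.
- by move=> x _; have [] := dF x.
- exact/cvg_at_right_filter/cF.
- by move=> x _; rewrite derive1E; have [_] := dF x.
Qed.

Lemma integral_expcs a b p q : a < 0 ->
  mu.-integrable `[0, +oo[ (EFin \o (expcs a b (a * p + b * q) (a * q - b * p))) /\
  \int[mu]_(x in `[0%R, +oo[) expcs a b (a * p + b * q) (a * q - b * p) x = - p.
Proof.
move=> a0; set A := a * p + b * q; set B := a * q - b * p.
pose K := `|A| + `|B|.
have K0 : 0 <= K by rewrite addr_ge0.
have measurable_expR_mul c d r s : measurable_fun (setT : set R) (expcs c d r s).
  by apply: continuous_measurable_fun; exact: continuous_expcs.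
have mK : measurable_fun (setT : set R) (fun x => K * expR (a * x)).
  have -> : (fun x => K * expR (a * x)) = expcs a 0 K 0.
    by apply/funext => y; rewrite /expcs !mul0r cos0 ?sin0; ring.
  exact: measurable_expR_mul.
have iK : mu.-integrable `[0, +oo[ (EFin \o (fun x => K * expR (a * x))) /\
    \int[mu]_(x in `[0%R, +oo[) (K * expR (a * x)) = - (K / a).
  (* The case [b = p = q = 0] integrates the added term alone. *)
  have := @integral_expcs_ge0 a 0 0 0 K a0; rewrite !(mulr0, mul0r, addr0, subr0) normr0.
  move=> /(_ _)/=; rewrite addr0 add0r => /(_ K0) iE.
  have e : (\int[mu]_(x in `[0%R, +oo[) (K * expR (a * x))%:E = (- (K / a))%:E)%E.
    rewrite -iE; apply: eq_integral => x _; congr EFin.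
    by rewrite /expcs !mul0r !addr0 mulr0 add0r.
  split; last by rewrite /Rintegral e.
  apply/integrableP; split.
    by apply/measurable_EFinP/measurable_funTS.
  under eq_integral do rewrite gee0_abs ?lee_fin ?mulr_ge0 ?expR_ge0//.
  by rewrite e ltry.
have iE := integral_expcs_ge0 a0 (lexx K).
have iS : mu.-integrable `[0, +oo[ (EFin \o (fun x => expcs a b A B x + K * expR (a * x))).
  apply/integrableP; split.
    apply/measurable_EFinP/measurable_funTS/measurable_funD; [exact: measurable_expR_mul|exact: mK].
  apply: (@le_lt_trans _ _ (- (p + K / a))%:E); last exact: ltry.
  rewrite -iE le_eqVlt.
  apply/orP; left; apply/eqP; apply: eq_integral => x _; rewrite /= ger0_norm//.
  have := abs_expcs a b A B x.
  rewrite ler_norml => /andP[+ _]; rewrite -/K; lra.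
have iD : mu.-integrable `[0, +oo[ (EFin \o (expcs a b A B)).
  rewrite (_ : _ \o _ = ((EFin \o (fun x => expcs a b A B x + K * expR (a * x))%R) \-
     (EFin \o (fun x => K * expR (a * x))%R))%E).
    by apply: integrableB => //; exact: iK.1.
  by apply/funext => x /=; rewrite -EFinB addrK.
split=> //.
have mi : measurable (`[0, +oo[%classic : set (measurableTypeR R)) by [].
have := RintegralD mi iD iK.1; rewrite iK.2.
rewrite {1}/Rintegral iE /=; lra.
Qed.

End Exponentials.

(** * Complex exponentials on the half-line and their inner products *)

Section ComplexExponentials.
Variable R : realType.
Notation C := R[i].
Notation Re := (@complex.Re R).
Notation Im := (@complex.Im R).
Notation mu := (@lebesgue_measure R).
Implicit Types (f h : R -> C) (D : set R) (x t : R) (z w : C).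

Lemma cexpD z w : cexp (z + w) = cexp z * cexp w.
Proof.
apply: complexP; rewrite /cexp ?Re_mul ?Im_mul /= !ReImE expRD ?cosD ?sinD; ring.
Qed.

Lemma cexp_conj z : cexp (conjc z) = conjc (cexp z).
Proof.
by apply: complexP; rewrite ReImE /= !ReImE ?cosN ?sinN ?mulrN.
Qed.

Lemma csq_cexp z : csq (cexp z) = expR (Re z) ^+ 2.
Proof.
rewrite /csq /cexp /= !exprMn -mulrDr cos2Dsin2 mulr1//.
Qed.

Lemma cexp0 : cexp (0 : C) = 1.
Proof. by apply: complexP; rewrite /= expR0 ?cos0 ?sin0 ?mulr1 ?mulr0. Qed.

Lemma cexp_real (r : R) : cexp (r%:C) = (expR r)%:C.
Proof. by apply: complexP; rewrite /= ?cos0 ?sin0 ?mulr1 ?mulr0. Qed.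

Lemma Re_mulr z x : Re (z * x%:C) = Re z * x.
Proof. by rewrite Re_mul /=; ring. Qed.
Lemma Im_mulr z x : Im (z * x%:C) = Im z * x.
Proof. by rewrite Im_mul /=; ring. Qed.

Lemma cexp_expcs z x :
  cexp (z * x%:C) = expcs (Re z) (Im z) 1 0 x +i* expcs (Re z) (Im z) 0 1 x.
Proof.
by apply: complexP; rewrite /= Re_mulr Im_mulr /expcs; ring.
Qed.

Lemma cmeas_cexp z : cmeas (fun x => cexp (z * x%:C)).
Proof.
have m p q : measurable_fun (setT : set R) (expcs (Re z) (Im z) p q).
  by apply: continuous_measurable_fun; exact: continuous_expcs.
split.
  rewrite (_ : _ \o _ = expcs (Re z) (Im z) 1 0); first exact: m.
  by apply/funext => x; rewrite -[LHS]/(Re (cexp (z * x%:C))) cexp_expcs.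
rewrite (_ : _ \o _ = expcs (Re z) (Im z) 0 1); first exact: m.
by apply/funext => x; rewrite -[LHS]/(Im (cexp (z * x%:C))) cexp_expcs.
Qed.

Lemma restrE D f x : restr D f x = if x \in D then f x else 0. Proof. by []. Qed.

Lemma mem_pos x : (x \in `[0%R, +oo[%classic) = (0 <= x).
Proof. by rewrite mem_setE in_itv/= andbT. Qed.

Lemma exponentE z x : exponent z x = if x \in `[0%R, +oo[%classic then cexp (z * x%:C) else 0.
Proof. by []. Qed.

Lemma cint_exponent w : Re w < 0 ->
  cint (exponent w) /\ cintegral setT (exponent w) = - w^-1.
Proof.
move=> w0; pose a := Re w; pose b := Im w; pose n := a ^+ 2 + b ^+ 2.
have n0 : n != 0 by rewrite paddr_eq0 ?sqr_ge0// negb_and sqrf_eq0 lt_eqF.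
(* The pairs (p, q) solve a p + b q = 1, a q - b p = 0, then the same system with right-hand sides
   0, 1: they give antiderivatives of e^{ax} cos(bx) and of e^{ax} sin(bx). *)
have [i1 v1] := integral_expcs b (a / n) (b / n) w0.
have [i2 v2] := integral_expcs b (- b / n) (a / n) w0.
have e1 : expcs a b (a * (a / n) + b * (b / n)) (a * (b / n) - b * (a / n)) = expcs a b 1 0.
  by congr expcs; rewrite ?/n; field.
have e2 : expcs a b (a * (- b / n) + b * (a / n)) (a * (a / n) - b * (- b / n)) = expcs a b 0 1.
  by congr expcs; rewrite ?/n; field.
rewrite -/a e1 in i1 v1; rewrite -/a e2 in i2 v2.
have m : measurable (`[0, +oo[%classic : set (measurableTypeR R)) by [].
split.
  split.
    rewrite (_ : _ \o _ = (EFin \o expcs a b 1 0) \_ `[0, +oo[).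
      by apply/(integrable_mkcond _ m).
    apply/funext => x; rewrite patchE -[LHS]/((Re (exponent w x))%:E) exponentE.
    by case: ifP => // _; rewrite cexp_expcs.
  rewrite (_ : _ \o _ = (EFin \o expcs a b 0 1) \_ `[0, +oo[).
    by apply/(integrable_mkcond _ m).
  apply/funext => x; rewrite patchE -[LHS]/((Im (exponent w x))%:E) exponentE.
  by case: ifP => // _; rewrite cexp_expcs.
rewrite /exponent -cintegral_restr /cintegral.
have -> : \int[mu]_(x in `[0%R, +oo[) Re (cexp (w * x%:C)) = - (a / n).
  by rewrite -v1; apply: eq_Rintegral => x _; rewrite cexp_expcs.
have -> : \int[mu]_(x in `[0%R, +oo[) Im (cexp (w * x%:C)) = - (- b / n).
  by rewrite -v2; apply: eq_Rintegral => x _; rewrite cexp_expcs.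
rewrite (_ : w = a +i* b); last by apply: complexP.
by apply: complexP; rewrite /= ?mulNr.
Qed.

Lemma exponent_mul_conj w z x : exponent w x * conjc (exponent z x) = exponent (w + conjc z) x.
Proof.
rewrite !exponentE; case: ifP => _; last by rewrite mul0r.
rewrite -cexp_conj -cexpD; congr cexp.
by apply: complexP; rewrite !ReImE /=; ring.
Qed.

Lemma L2_exponent w : Re w < 0 -> L2 (exponent w).
Proof.
move=> w0; apply: (@L2_dom _ _ (Re \o exponent (w + conjc w))).
- by apply: cmeas_restr => //; exact: cmeas_cexp.
- by move=> x; rewrite /= -exponent_mul_conj csqE.
- have [] := cint_exponent (w := w + conjc w); last by case.
  by rewrite !ReImE; lra.
Qed.

Lemma inner_exponent w z : Re w < 0 -> Re z < 0 ->
  inner (exponent w) (exponent z) = - (w + conjc z)^-1.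
Proof.
move=> w0 z0; rewrite /inner.
under eq_cintegral do rewrite exponent_mul_conj.
by have [|_] := cint_exponent (w := w + conjc z); first by rewrite !ReImE; lra.
Qed.

(** Evaluation of the transform at a point of the right half-plane becomes a functional of [f] that
    Cauchy-Schwarz controls. *)
Lemma laplaceE f z : laplace f z = inner f (exponent (- conjc z)).
Proof.
rewrite /laplace cintegral_restr; apply: eq_cintegral => x.
rewrite exponentE restrE; case: ifP => _; last by rewrite conjc0 mulr0.
rewrite -cexp_conj mulrC; congr (_ * cexp _).
by apply: complexP; rewrite !ReImE /=; ring.
Qed.

Lemma Hplus_exponent w : Re w < 0 -> Hplus (exponent w).
Proof.
move=> w0; split; first exact: L2_exponent.
apply: aeW => x; rewrite exponentE /= => x0.
by case: ifPn => //; rewrite mem_pos in_itv/= andbT in x0 *.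
Qed.

End ComplexExponentials.

(** * Injectivity of the Laplace transform *)

Section LaplaceInjective.
Variable R : realType.
Notation C := R[i].
Notation Re := (@complex.Re R).
Notation Im := (@complex.Im R).
Notation mu := (@lebesgue_measure R).
Implicit Types (f h : R -> C) (D : set R) (x t : R) (z w : C).

(* [(1 - y^m)^(2^m)] tends to 1 for [y < 1/2] and to 0 for [1/2 < y <= 1]. *)
Definition threshold (m : nat) (y : R) := (1 - y ^+ m) ^+ (2 ^ m).

Lemma bernoulli_ge (n : nat) (y : R) : 0 <= y <= 1 -> 1 - n%:R * y <= (1 - y) ^+ n.
Proof.
move=> /andP[y0 y1]; elim: n => [|n IH]; first by rewrite mul0r subr0 expr0.
rewrite exprS -natr1.
have n0 : 0 <= n%:R :> R by [].
apply: le_trans (_ : (1 - y) * (1 - n%:R * y) <= _); first nra.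
by rewrite ler_wpM2l// subr_ge0.
Qed.

Lemma threshold_le1 m y : 0 <= y <= 1 -> 0 <= threshold m y <= 1.
Proof.
move=> /andP[y0 y1]; have ym : y ^+ m <= 1 by rewrite exprn_ile1.
rewrite /threshold exprn_ge0 ?subr_ge0// exprn_ile1 ?subr_ge0//.
by rewrite lerBlDr lerDl exprn_ge0.
Qed.

(** Bernoulli's inequality gives the lower bound 1 - (2y)^m. *)
Lemma threshold_cvg1 y : 0 <= y -> 2 * y < 1 -> threshold m y @[m --> \oo] --> (1:R).
Proof.
move=> y0 y1; have y01 : 0 <= y <= 1 by rewrite y0 /=; lra.
have g : 1 - (2 * y) ^+ m @[m --> \oo] --> (1:R).
  rewrite -[X in _ --> X]subr0; apply: cvgB; first exact: cvg_cst.
  by apply: cvg_expr; rewrite ger0_norm ?mulr_ge0.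
apply: squeeze_cvgr g (cvg_cst (1:R)); apply: nearW => m.
have /andP[_ ->] := threshold_le1 m y01; rewrite andbT /threshold exprMn -natrX.
by apply: bernoulli_ge; rewrite exprn_ge0//= exprn_ile1//; lra.
Qed.

(** From 1 - u <= e^{-u} comes the upper bound e^{-(2y)^m} <= (2y)^{-m}. *)
Lemma threshold_cvg0 y : 1 < 2 * y -> y <= 1 -> threshold m y @[m --> \oo] --> (0:R).
Proof.
move=> y0 y1; have yp : 0 < y by lra.
have y01 : 0 <= y <= 1 by rewrite y1 ltW.
have g : ((2 * y)^-1) ^+ m @[m --> \oo] --> (0:R).
  by apply: cvg_expr; rewrite ger0_norm ?invr_ge0 ?mulr_ge0 ?(ltW yp)// invf_lt1//; lra.
apply: squeeze_cvgr (cvg_cst (0:R)) g; apply: nearW => m.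
have /andP[-> _] := threshold_le1 m y01; rewrite /= /threshold.
have e : 1 - y ^+ m <= expR (- y ^+ m) by have := expR_ge1Dx (- y ^+ m).
apply: (@le_trans _ _ (expR (- y ^+ m) ^+ (2 ^ m))).
  by apply: lerXn2r; rewrite ?nnegrE ?expR_ge0// subr_ge0 exprn_ile1// ltW.
rewrite -expRM_natl mulrN expRN natrX -exprMn exprVn lef_pV2 ?posrE ?expR_gt0 ?exprn_gt0//.
- by apply: le_trans (expR_ge1Dx _); rewrite lerDr.
- lra.
Qed.

Section unique.
Variable F : R -> R.
Hypothesis iF : mu.-integrable setT (EFin \o F).
Hypothesis Fneg : forall x, x < 0 -> F x = 0.
Hypothesis LF : forall s, 0 <= s -> Rintegral mu setT (fun x => expR (- s * x) * F x) = 0.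

Lemma measurable_expR_mul s : measurable_fun (setT : set R) (fun x => expR (- s * x)).
Proof.
apply: (measurableT_comp (@measurable_expR R)).
exact: measurable_funM.
Qed.

Lemma integrable_bounded (g : R -> R) : measurable_fun (setT : set R) g ->
  (forall x, 0 <= x -> `|g x| <= 1) -> mu.-integrable setT (EFin \o (fun x => g x * F x)).
Proof.
move=> mg g1; apply: le_integrable iF => //.
  apply/measurable_EFinP/measurable_funM => //.
  by apply/measurable_EFinP; exact: measurable_int iF.
move=> x _ /=; rewrite lee_fin normrM.
have [x0|x0] := leP 0 x; last by rewrite Fneg// normr0 mulr0.
by rewrite -[leRHS]mul1r ler_wpM2r// g1.
Qed.

(** With q = e^{-cx}, (1 - q)^{n+1} e^{-sx} is a difference of two terms of order n with rates s and
    s + c; hence [s] varies in the induction. *)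
Lemma Rintegral_oneminus n c s : 0 <= c -> 0 <= s ->
  Rintegral mu setT (fun x => ((1 - expR (- c * x)) ^+ n * expR (- s * x)) * F x) = 0.
Proof.
move=> c0; elim: n s => [|n IH] s s0.
  by under eq_Rintegral do rewrite expr0 mul1r; exact: LF.
have i r : 0 <= r -> mu.-integrable setT
    (EFin \o (fun x => ((1 - expR (- c * x)) ^+ n * expR (- r * x)) * F x)).
  move=> r0; apply: integrable_bounded.
    apply: measurable_funM; last exact: measurable_expR_mul.
    by apply: measurable_funX; apply: measurable_funB => //; exact: measurable_expR_mul.
  move=> x x0.
  have e1 q : 0 <= q -> 0 <= expR (- q * x) <= 1.
    by move=> q0; rewrite expR_ge0 -expR0 ler_expR mulNr oppr_le0 mulr_ge0.
  have /andP[? ?] := e1 _ c0; have /andP[? ?] := e1 _ r0.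
  rewrite ger0_norm ?mulr_ge0 ?exprn_ge0 ?subr_ge0//.
  by rewrite mulr_ile1// ?exprn_ge0 ?exprn_ile1 ?subr_ge0//; lra.
have -> : Rintegral mu setT (fun x => ((1 - expR (- c * x)) ^+ n.+1 * expR (- s * x)) * F x) =
  Rintegral mu setT (fun x => ((1 - expR (- c * x)) ^+ n * expR (- s * x)) * F x -
   ((1 - expR (- c * x)) ^+ n * expR (- (s + c) * x)) * F x).
  apply: eq_Rintegral => x _.
  rewrite [in RHS](_ : - (s + c) * x = - c * x + - s * x); last by ring.
  by rewrite expRD exprSr; ring.
by rewrite RintegralB ?IH ?subr0 ?addr_ge0//; apply: i; rewrite ?addr_ge0.
Qed.

(** The functions [threshold m] of e^{-cx} are combinations of exponentials, so [F] integrates to 0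
    against them, and they converge boundedly to the indicator of ]a, +oo[ off the point a. *)
Lemma tail_eq0 (a : R) : 0 < a -> Rintegral mu setT (fun x => \1_(`]a, +oo[%classic : set R) x * F x) = 0.
Proof.
(* Then e^{-ca} = 1/2, the jump of the threshold. *)
move=> a0; pose c := ln 2 / a.
have l2 : 0 < ln (2:R) by rewrite ln_gt0// ltr1n.
have c0 : 0 < c by rewrite divr_gt0.
pose f_ m x : \bar R := (threshold m (expR (- c * x)) * F x)%:E.
have mstep m : measurable_fun (setT : set R) (fun x => threshold m (expR (- c * x))).
  apply: measurable_funX; apply: measurable_funB => //; apply: measurable_funX.
  exact: measurable_expR_mul.
have stepb m x : 0 <= x -> 0 <= threshold m (expR (- c * x)) <= 1.
  move=> x0; apply: threshold_le1; rewrite expR_ge0 -expR0 ler_expR mulNr oppr_le0 mulr_ge0//.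
  exact: ltW.
have i m : mu.-integrable setT (EFin \o (fun x => threshold m (expR (- c * x)) * F x)).
  apply: integrable_bounded => // x /stepb h.
  by have /andP[h0 h1] := h m; rewrite ger0_norm.
have i1 : mu.-integrable setT (EFin \o (fun x => \1_(`]a, +oo[%classic : set R) x * F x)).
  apply: integrable_bounded => // x _; rewrite indicE; case: (_ \in _) => /=; rewrite ?normr1 ?normr0//.
have [] := @dominated_convergence _ _ R mu setT measurableT f_
  (EFin \o (fun x => \1_(`]a, +oo[%classic : set R) x * F x)) (fun x => `|(EFin \o F) x|%E).
- by move=> n; exact: measurable_int (i n).
- exact: measurable_int i1.
(* At x = a the base is exactly 1/2, where [threshold] has no limit at hand; this point is null. *)
- have : mu.-negligible [set a] by apply/negligibleP => //; exact: lebesgue_measure_set1.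
  case=> N [mN N0 aN]; exists N; split => // x nP; apply: aN => /=.
  apply: contrapT => xa; apply: nP => _; rewrite /f_ /=.
  apply: cvg_EFin; first exact: nearW.
  have [x0|x0] := leP 0 x; last first.
    by rewrite Fneg// mulr0 (_ : _ \o _ = cst 0); [exact: cvg_cst|apply/funext => m /=; rewrite mulr0].
  rewrite (_ : _ \o _ = fun m => threshold m (expR (- c * x)) * F x)//.
  apply: cvgMl.
  have y2 : 2 * expR (- c * x) = expR (ln 2 * (1 - x / a)).
    rewrite -{1}(lnK (x := 2)) ?posrE// -expRD; congr expR; rewrite /c; field; exact: lt0r_neq0.
  have indE : \1_(`]a, +oo[%classic : set R) x = if (a < x)%R then 1 else 0 :> R.
    by rewrite indicE mem_setE in_itv/= andbT; case: ifP.
  rewrite indE; have [ax|xa'] := ltP a x.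
    apply: threshold_cvg1; first exact: expR_ge0.
    rewrite y2 expR_lt1 pmulr_rlt0// subr_lt0 ltr_pdivlMr// mul1r//.
  have {}xa : x < a by rewrite lt_neqAle xa' andbT; apply/eqP.
  apply: threshold_cvg0; last by rewrite -expR0 ler_expR mulNr oppr_le0 mulr_ge0// ltW.
  by rewrite y2 expR_gt1 mulr_gt0// subr_gt0 ltr_pdivrMr// mul1r.
- exact: integrable_abse.
- apply: aeW => x n _; rewrite /f_ /= lee_fin normrM.
  have [x0|x0] := leP 0 x; last by rewrite Fneg// normr0 mulr0.
  have /andP[? ?] := stepb n x x0.
  by rewrite -[leRHS]mul1r ler_wpM2r// ger0_norm.
move=> _ _ h.
have e : (fun m => \int[mu]_x f_ m x)%E = cst 0%E.
  apply/funext => m /=.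
  (* The power (e^{-cx})^m is the exponential of rate m c. *)
  have := @Rintegral_oneminus (2 ^ m) (m%:R * c) 0 (mulr_ge0 (ler0n _ _) (ltW c0)) (lexx _).
  move=> {}h.
  have : Rintegral mu setT (fun x => threshold m (expR (- c * x)) * F x) = 0.
    rewrite -h; apply: eq_Rintegral => x _.
    by rewrite oppr0 mul0r expR0 mulr1 /threshold -expRM_natl mulrA mulrN.
  rewrite /Rintegral => h0; rewrite -[LHS]fineK; last exact: integrable_fin_num (i m).
  by rewrite h0.
have {}h : (fun m => \int[mu]_x f_ m x)%E @ \oo -->
  (\int[mu]_x (\1_(`]a, +oo[%classic : set R) x * F x)%:E)%E := h.
rewrite e in h; rewrite /Rintegral.
have -> // : (\int[mu]_x (\1_(`]a, +oo[%classic : set R) x * F x)%:E)%E = 0%E.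
by apply/esym; apply: (cvg_unique _ _ h) => //; exact: cvg_cst.
Qed.

(** The primitive [Phi] of [F] vanishes identically: left of 0 because [F] does, right of 0 because
    the full integral and the tails do. Lebesgue's differentiation theorem then recovers [F] from
    it. *)
Lemma laplace_unique : {ae mu, forall x, F x = 0}.
Proof.
have F0 : Rintegral mu setT F = 0.
  by rewrite -(LF (lexx 0)); apply: eq_Rintegral => x _; rewrite oppr0 mul0r expR0 mul1r.
have iFs x b : mu.-integrable [set` Interval -oo%O (BSide b x)] (EFin \o F).
  by apply: (integrableS measurableT _ _ iF).
pose Phi x := (\int[mu]_(t in `]-oo, x]) F t)%R.
have Phi0 x : Phi x = 0.
  have [x0|x0] := leP x 0.
    rewrite /Phi -Rintegral_itv_bndo_bndc; last first.
      exact: iFs.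
    rewrite /Rintegral integral0_eq// => t; rewrite /= in_itv/= => tx.
    by rewrite Fneg// (lt_le_trans tx).
  rewrite /Phi Rintegral_mkcond.
  have i1 : mu.-integrable setT (EFin \o (fun t => \1_(`]x, +oo[%classic : set R) t * F t)).
    by apply: integrable_bounded => // t _; rewrite indicE; case: (_ \in _) => /=; rewrite ?normr1 ?normr0.
  rewrite -[RHS](subr0 0) -{1}F0 -(tail_eq0 x0) -RintegralB//.
  apply: eq_Rintegral => t _; rewrite patchE indicE mem_setE in_itv/=.
  rewrite -[t \in _]/(t \in [set` `]x, +oo[]) mem_setE in_itv/= andbT ltNge.
  by case: (t <= x); rewrite /= ?mul0r ?subr0 ?mul1r ?subrr.
have PhiE : Phi = cst 0 by apply/funext => x; exact: Phi0.
have : {ae mu, forall x, derivable Phi x 1 /\ derive1 Phi x = F x}.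
  exact: FTC1Ny (fun y => iFs y false) (open_integrable_locally openT iF).
by rewrite PhiE; apply: aeS => x [_ <-]; rewrite derive1_cst.
Qed.

End unique.

(** A square-integrable function need not be integrable, so uniqueness is applied to f(x) e^{-x},
    whose transform at s >= 0 is that of [f] at s + 1. As the points are real, real and imaginary
    parts separate. *)
Lemma laplace_injective f : Hplus f -> (forall r, 0 < r -> laplace f r%:C = 0) ->
  eqae f (fun=> 0).
Proof.
move=> [lf sf] Lf.
pose G x := f x * conjc (exponent (-1) x).
have e1 : Re (-1 : C) < 0 by rewrite ReImE ltrN10.
have [iR iI] : cint G by apply: L2_cint => //; exact: L2_exponent.
have G0 x : x < 0 -> G x = 0.
  by move=> x0; rewrite /G exponentE mem_pos leNgt x0 conjc0 mulr0.
have LG s : 0 <= s -> cintegral setT (fun x => (expR (- s * x))%:C * G x) = 0.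
  move=> s0; rewrite -(Lf (s + 1)) ?ltr_wpDl// laplaceE; apply: eq_cintegral => x.
  rewrite /G mulrCA; congr (_ * _); rewrite !exponentE; case: ifP => _; last by rewrite conjc0 mulr0.
  rewrite -!cexp_conj -cexp_real -cexpD; congr cexp.
  by apply: complexP; rewrite !ReImE /=; ring.
have uR : {ae mu, forall x, Re (G x) = 0}.
  apply: (@laplace_unique (Re \o G)) => //.
    by move=> x x0; rewrite /= G0.
  move=> s s0; transitivity (Re (cintegral setT (fun x => (expR (- s * x))%:C * G x))).
    by apply: eq_Rintegral => x _; rewrite Re_mul /= mul0r subr0.
  by rewrite LG.
have uI : {ae mu, forall x, Im (G x) = 0}.
  apply: (@laplace_unique (Im \o G)) => //.
    by move=> x x0; rewrite /= G0.
  move=> s s0; transitivity (Im (cintegral setT (fun x => (expR (- s * x))%:C * G x))).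
    by apply: eq_Rintegral => x _; rewrite Im_mul /= mul0r addr0.
  by rewrite LG.
have := aeS2 (fun x a b => conj (a : Re (G x) = 0) (b : Im (G x) = 0)) uR uI.
apply: aeS2 sf => x fx [r i].
have [x0|x0] := leP 0 x; last by apply: fx; rewrite /= in_itv/= andbT leNgt x0.
have : G x = 0 by exact: complexP.
rewrite /G exponentE mem_pos x0 => /eqP; rewrite mulf_eq0 => /orP[/eqP//|/eqP h].
have := csq_cexp (-1 * x%:C); rewrite -csq_conj h => /esym/eqP.
by rewrite /csq /= !expr0n addr0 sqrf_eq0 gt_eqF// expR_gt0.
Qed.

End LaplaceInjective.

(** * The Blaschke product and its convolution kernel *)

Section PartialFractions.
Variable F : fieldType.

(** Over the common denominator the numerator [q] has degree at most n and vanishes at the n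
    distinct points [m j], so it is a constant multiple of the product of the z - m_j. The second
    identity is its value at [l n]. *)
Lemma partial_fractions n (l m a : nat -> F) :
  (forall i j, (i < n)%N -> (j < n)%N -> m i = m j -> i = j) ->
  (forall i j, (i <= n)%N -> (j < n)%N -> m j != l i) ->
  (forall j, (j < n)%N -> \sum_(i < n.+1) a i / (m j - l i) = 0) ->
  exists c, (forall z, (forall i, (i <= n)%N -> z != l i) ->
    \sum_(i < n.+1) a i / (z - l i) =
      c * \prod_(j < n) (z - m j) / \prod_(i < n.+1) (z - l i)) /\
  a n * \prod_(i < n) (l n - l i) = c * \prod_(j < n) (l n - m j).
Proof.
move=> minj ml ma.
pose q := \sum_(i < n.+1) a i *: \prod_(k < n.+1 | k != i) ('X - (l k)%:P).
have qz z : (forall i, (i <= n)%N -> z != l i) ->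
    q.[z] = (\sum_(i < n.+1) a i / (z - l i)) * \prod_(i < n.+1) (z - l i).
  move=> zl; rewrite horner_sum mulr_suml; apply: eq_bigr => i _.
  rewrite hornerZ horner_prod [in RHS](bigD1 i)//= mulrA divfK; last first.
    by rewrite subr_eq0 zl// -ltnS.
  by congr (_ * _); apply: eq_bigr => k _; rewrite !hornerE.
have csq : (size q <= n.+1)%N.
  apply: (leq_trans (size_sum _ _ _)); apply/bigmax_leqP => i _.
  apply: (leq_trans (size_scale_leq _ _)).
  rewrite -big_filter size_prod_XsubC ltnS size_filter -sum1_count sum1_card.
  by rewrite (cardC1 i) card_ord.
pose rs := [seq m j | j <- index_iota 0 n].
have urs : uniq rs.
  rewrite map_inj_in_uniq ?iota_uniq// => i j; rewrite !mem_index_iota => /andP[_ ?] /andP[_ ?].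
  exact: minj.
have rrs : all (root q) rs.
  apply/allP => _ /mapP[j + ->]; rewrite mem_index_iota => /andP[_ jn].
  by rewrite rootE qz ?ma ?mul0r// => i i_n; exact: ml.
have [q' qE] := uniq_roots_prod_XsubC rrs (etrans (uniq_rootsE rs) urs).
have sr : size (\prod_(z <- rs) ('X - z%:P)) = n.+1.
  by rewrite size_prod_XsubC size_map size_iota subn0.
have [c q'c] : exists c, q' = c%:P.
  have [->|q0] := eqVneq q' 0; first by exists 0.
  exists q'`_0; apply: size1_polyC.
  have := csq; rewrite qE size_Mmonic ?monic_prod_XsubC// sr addnS /= => h.
  by rewrite -(leq_add2r n) add1n.
have qE' z : q.[z] = c * \prod_(j < n) (z - m j).
  rewrite qE q'c hornerM hornerC horner_prod /rs big_map big_mkord.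
  by congr (_ * _); apply: eq_bigr => k _; rewrite !hornerE.
exists c; split.
  move=> z zl; rewrite -qE' qz// mulfK//.
  by apply/prodf_neq0 => i _; rewrite subr_eq0 zl// -ltnS.
(* At [l n] every summand but the last contains a vanishing factor. *)
rewrite -qE' horner_sum (bigD1 ord_max)//= [X in _ + X]big1 ?addr0.
  rewrite hornerZ horner_prod; congr (_ * _).
  rewrite [RHS]big_mkcond big_ord_recr /= eqxx mulr1; apply: eq_bigr => i _.
  by rewrite !hornerE -val_eqE /= ltn_eqF.
move=> i imax; rewrite hornerZ horner_prod (bigD1 ord_max)/=; last by rewrite eq_sym.
by rewrite hornerXsubC subrr mul0r mulr0.
Qed.

End PartialFractions.

(** * Gram-Schmidt orthogonalization of the exponentials *)

Section GramSchmidt.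
Variable R : realType.
Notation C := R[i].
Notation Re := (@complex.Re R).
Notation Im := (@complex.Im R).
Notation mu := (@lebesgue_measure R).
Implicit Types (f h : R -> C) (z : C).

Lemma conjcM (z w : C) : conjc (z * w) = conjc z * conjc w.
Proof. exact: rmorphM. Qed.

Lemma conjcB (z w : C) : conjc (z - w) = conjc z - conjc w.
Proof. exact: rmorphB. Qed.

Lemma conjcN (z : C) : conjc (- z) = - conjc z.
Proof. exact: rmorphN. Qed.

Lemma conjc_prod n (z : 'I_n -> C) : conjc (\prod_(i < n) z i) = \prod_(i < n) conjc (z i).
Proof. exact: rmorph_prod. Qed.

Section Spanned.
Variable e : nat -> R -> C.

Definition spanned n f := exists a : nat -> C, eqae f (fun x => \sum_(i < n) a i * e i x).

Lemma spanned_lin n (c : C) f h : spanned n f -> spanned n h ->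
  spanned n (fun x => f x + c * h x).
Proof.
move=> [a fa] [b hb]; exists (fun i => a i + c * b i).
move: fa hb; apply: aeS2 => x -> ->.
by rewrite mulr_sumr -big_split; apply: eq_bigr => i _; rewrite mulrDl mulrA.
Qed.

Lemma spanned0 n : spanned n (fun=> 0).
Proof.
by exists (fun=> 0); apply: aeW => x; rewrite big1// => i _; rewrite mul0r.
Qed.

Lemma spanned_mono n m f : (n <= m)%N -> spanned n f -> spanned m f.
Proof.
move=> nm [a fa]; exists (fun i => if (i < n)%N then a i else 0).
move: fa; apply: aeS => x ->.
rewrite (big_ord_widen m (fun i => a i * e i x) nm) big_mkcond /=.
by apply: eq_bigr => i _; case: ifP; rewrite ?mul0r.
Qed.

Lemma spanned_sum n m (c : nat -> C) (F : nat -> R -> C) :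
  (forall i, (i < m)%N -> spanned n (F i)) ->
  spanned n (fun x => \sum_(i < m) c i * F i x).
Proof.
elim: m => [_|m IH h]; first by rewrite sumf0; exact: spanned0.
rewrite sumfS; apply: spanned_lin; last exact: h.
by apply: IH => i /ltnW /h.
Qed.

End Spanned.

Variables (J : pred nat) (lam : nat -> C) (g : nat -> R -> C).
Let e k := exponent (lam k).
Hypothesis Jdown : forall i j, (i <= j)%N -> J j -> J i.
Hypothesis lam0 : forall k, J k -> Re (lam k) < 0.
Hypothesis og : Defs.orthonormal J g.
Hypothesis gs : gram_schmidt J e g.

Let le k : J k -> L2 (e k). Proof. by move=> Jk; apply/L2_exponent/lam0. Qed.
Let lg k : J k -> L2 (g k). Proof. exact: og.1. Qed.

Let v k := fun x => \sum_(j < k) inner (e k) (g j) * g j x.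
Let u k := fun x => e k x - v k x.

Let lgj k j : J k -> (j < k)%N -> L2 (g j).
Proof. by move=> Jk jk; apply/lg/(Jdown (ltnW jk) Jk). Qed.

Let lv k : J k -> L2 (v k).
Proof.
by move=> Jk; exact: (L2_sum (fun j => inner (e k) (g j)) (fun j jk => lgj Jk jk)).
Qed.

Let lu k : J k -> L2 (u k).
Proof. by move=> Jk; apply: L2B; [exact: le|exact: lv]. Qed.

(** The inverse is 0 by convention if [u k] is null; [gs_normalized] rules this out for [k] in
    [J]. *)
Definition gs_coef k : R := (norm2 (u k))^-1.

Let gE k : J k -> eqae (g k) (fun x => (gs_coef k)%:C * u k x).
Proof. by move=> Jk; exact: gs. Qed.

Let inner_gv k m : J k -> J m -> (k <= m)%N -> inner (g m) (v k) = 0.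
Proof.
move=> Jk Jm km.
rewrite (inner_sumr (fun j => inner (e k) (g j)) (fun j jk => lgj Jk jk) (lg Jm)).
rewrite big1// => j _; have jk : (j < k)%N by [].
rewrite og.2//; last exact: Jdown (ltnW jk) Jk.
by rewrite gtn_eqF ?mulr0// (leq_trans jk).
Qed.

(** Expand the second factor of (g_k, g_k) = 1: the correction [v k] is orthogonal to g_k. *)
Lemma gs_normalized k : J k -> (gs_coef k)%:C * inner (g k) (e k) = 1.
Proof.
move=> Jk; have gg : inner (g k) (g k) = 1 by rewrite og.2// eqxx.
rewrite -gg [RHS](inner_ae (lg Jk) (lg Jk) (lg Jk) (L2Z _ (lu Jk)) (eqae_refl _) (gE Jk)).
rewrite innerZr; [|exact: lu|exact: lg].
rewrite innerBr; [|exact: le|exact: lv|exact: lg].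
by rewrite inner_gv// subr0 conjc_real.
Qed.

(** The normalizing factor is nonzero, so e_j is a combination of g_0, ..., g_j. *)
Lemma gs_orthogonal j k : J k -> (j < k)%N -> inner (g k) (e j) = 0.
Proof.
move=> Jk jk; have Jj := Jdown (ltnW jk) Jk.
have r0 : gs_coef j != 0.
  apply/eqP => r0; have := gs_normalized Jj; rewrite r0 mul0r => /eqP.
  by rewrite eq_sym oner_eq0.
have eE : eqae (e j) (fun x => ((gs_coef j)^-1)%:C * g j x + v j x).
  have := gE Jj; apply: aeS => x ->.
  rewrite mulrA -rmorphM /= mulVf// mul1r /u subrK//.
rewrite (inner_ae (lg Jk) (lg Jk) (le Jj) _ (eqae_refl _) eE); last first.
  by apply: L2D; [exact/L2Z/lg|exact: lv].
rewrite innerDr; [|exact/L2Z/lg|exact: lv|exact: lg].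
rewrite innerZr; [|exact: lg|exact: lg].
by rewrite inner_gv ?(ltnW jk)// og.2// gtn_eqF// mulr0 addr0.
Qed.

(** Distinct exponents are not assumed: equal ones would give (g_k, e_k) = (g_k, e_j) = 0, against
    [gs_normalized]. *)
Lemma gs_distinct j k : J k -> (j < k)%N -> lam j != lam k.
Proof.
move=> Jk jk; apply/eqP => jl; have := gs_normalized Jk.
have := gs_orthogonal Jk jk; rewrite /e jl => ->; rewrite mulr0 => /eqP.
by rewrite eq_sym oner_eq0.
Qed.

(** The leading coefficient is recorded because it fixes the modulus of the constant in [gs_laplace]
    and the value in [inner_gs_shift]. *)
Lemma gs_span k : J k -> exists a : nat -> C, a k = (gs_coef k)%:C /\
  eqae (g k) (fun x => \sum_(i < k.+1) a i * e i x).
Proof.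
elim/ltn_ind: k => k IH Jk.
have [b vb] : spanned e k (v k).
  apply: (@spanned_sum e k k (fun j => inner (e k) (g j)) g) => i ik; apply: (@spanned_mono _ i.+1) => //.
  have [a [_ ga]] := IH _ ik (Jdown (ltnW ik) Jk).
  by exists a.
exists (fun i => if i == k then (gs_coef k)%:C else - ((gs_coef k)%:C * b i)).
rewrite eqxx; split => //.
move: vb (gE Jk); apply: aeS2 => x vx ->; rewrite /u vx big_ord_recr /= eqxx.
rewrite mulrBr addrC mulr_sumr -sumrN; congr (_ + _).
by apply: eq_bigr => i _; rewrite ltn_eqF// mulNr mulrA.
Qed.

Definition partial_blaschke n z := \prod_(0 <= k < n | J k) ((z + conjc (lam k)) / (z - lam k)).

Lemma partial_blaschkeE n z : J n -> partial_blaschke n z =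
  \prod_(k < n) (z + conjc (lam k)) / \prod_(k < n) (z - lam k).
Proof.
move=> Jn; rewrite /partial_blaschke big_mkord -prodf_div big_mkcond; apply: eq_bigr => k _.
by rewrite (Jdown (ltnW (ltn_ord k)) Jn).
Qed.

Lemma Re_neq z (w : C) : 0 < Re z -> Re w < 0 -> z - w != 0.
Proof.
by move=> z0 w0; apply/eqP => /(congr1 Re); rewrite !ReImE /=; lra.
Qed.

(** The transform of g_n is a combination of the 1 / (z - lambda_i) with i <= n. At z = - conj
    lambda_j it equals (g_n, e_j), which is 0 for j < n; this determines the numerator up to the
    constant [c], whose modulus follows from the normalization. *)
Lemma gs_laplace n : J n -> exists2 c : C, csq c = - 2 * Re (lam n) &
  forall z, 0 < Re z -> laplace (g n) z = c * partial_blaschke n z / (z - lam n).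
Proof.
move=> Jn; have [a [an ga]] := gs_span Jn.
have Ji i : (i <= n)%N -> J i by move=> i_n; exact: Jdown Jn.
have lap z : 0 < Re z -> inner (g n) (exponent (- conjc z)) = \sum_(i < n.+1) a i / (z - lam i).
  move=> z0; have lz : L2 (exponent (- conjc z)) by apply: L2_exponent; rewrite !ReImE oppr_lt0.
  have les i : (i < n.+1)%N -> L2 (e i) by move=> i_n; apply: le; exact: Ji.
  rewrite (inner_ae (lg Jn) (L2_sum a les) lz lz ga (eqae_refl _)) inner_suml//.
  apply: eq_bigr => i _; congr (_ * _); rewrite inner_exponent; last 2 first.
  - by apply/lam0/Ji; rewrite -ltnS.
  - by rewrite !ReImE oppr_lt0.
  by rewrite conjcN conjcK -invrN opprD opprK addrC.
pose m j := - conjc (lam j).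
have Rem j : (j <= n)%N -> 0 < Re (m j) by move=> /Ji /lam0; rewrite !ReImE oppr_gt0.
have mE j : exponent (- conjc (m j)) = e j by rewrite conjcN conjcK opprK.
have ml i j : (i <= n)%N -> (j <= n)%N -> m j != lam i.
  by move=> /Ji /lam0 i0 /Rem mj; rewrite -subr_eq0; exact: Re_neq.
have [|||c [cE anE]] := @partial_fractions _ n lam m a.
- move=> i j i_n j_n /oppr_inj /(can_inj (@conjcK _)) ij.
  have [ilj|jli|//] := ltngtP i j.
  + by have := gs_distinct (Ji _ (ltnW j_n)) ilj; rewrite ij eqxx.
  + by have := gs_distinct (Ji _ (ltnW i_n)) jli; rewrite ij eqxx.
- by move=> i j i_n /ltnW; exact: ml.
- by move=> j jn; rewrite -lap ?Rem ?(ltnW jn)// mE gs_orthogonal.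
have zl z : 0 < Re z -> forall i, (i <= n)%N -> z != lam i.
  by move=> z0 i i_n; rewrite -subr_eq0; apply: Re_neq => //; exact/lam0/Ji.
exists c; last first.
  move=> z z0; rewrite laplaceE lap// cE; last exact: zl.
  rewrite partial_blaschkeE// big_ord_recr /= invfM !mulrA; congr (_ * _ / _ / _).
  by apply: eq_bigr => i _; rewrite /m opprK.
pose A := \prod_(j < n) (m n - m j); pose B := \prod_(j < n) (m n - lam j).
pose sgn : C := \prod_(j < n) (-1).
have sgn0 : sgn != 0 by apply/prodf_neq0 => i _; rewrite oppr_eq0 oner_eq0.
have B0 : B != 0 by apply/prodf_neq0 => i _; rewrite subr_eq0 ml// ltnW.
(* This is [anE] conjugated: each factor conj (lambda_n - lambda_i) is -(m_n - m_i), each conj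
   (lambda_n - m_j) is -(m_n - lambda_j), and the common sign [sgn] cancels. *)
have rA : (gs_coef n)%:C * A = conjc c * B.
  apply: (mulfI sgn0).
  transitivity (conjc (a n * \prod_(i < n) (lam n - lam i))).
    rewrite an conjcM conjc_real mulrCA; congr (_ * _); rewrite conjc_prod -big_split.
    by apply: eq_bigr => i _; rewrite conjcB /m /=; ring.
  rewrite anE conjcM mulrCA; congr (_ * _); rewrite conjc_prod -big_split.
  by apply: eq_bigr => i _; rewrite conjcB /m conjcN conjcK /=; ring.
have D0 : m n - lam n != 0 by rewrite subr_eq0 ml.
(* At z = m_n the transform is (g_n, e_n), which the normalization fixes. *)
have := gs_normalized Jn; rewrite -/(e n) -mE lap ?Rem// cE; last by apply: zl; exact: Rem.
rewrite big_ord_recr /= -/A -/B.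
rewrite (_ : _ * _ = (gs_coef n)%:C * A * c / (B * (m n - lam n))); last by ring.
rewrite rA => h.
have : c * conjc c = m n - lam n.
  by rewrite -[RHS]mul1r -h; field; rewrite B0 D0.
by rewrite csqE => /(congr1 Re); rewrite !ReImE /= => ->; ring.
Qed.

End GramSchmidt.

(** * The square-integrable function with transform Theta - 1 *)

Section Kernel.
Variable R : realType.
Notation C := R[i].
Notation Re := (@complex.Re R).
Notation Im := (@complex.Im R).
Notation mu := (@lebesgue_measure R).
Implicit Types (f h : R -> C) (z : C).

Lemma cvg_csq (s : nat -> C) (l : C) :
  (forall eps : R, 0 < eps -> exists N, forall n, (N <= n)%N -> csq (s n - l) <= eps) ->
  (Re (s n) @[n --> \oo] --> Re l) /\ (Im (s n) @[n --> \oo] --> Im l).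
Proof.
move=> sl; split; apply/cvgrPdist_le => eps eps0;
  have [N NP] := sl (eps ^+ 2) (exprn_gt0 2 eps0);
  exists N => // n /= /NP; rewrite /csq !ReImE => le.
- rewrite -ler_sqr ?nnegrE ?(ltW eps0)// real_normK ?num_real//; apply: le_trans le.
  by rewrite -[in leLHS]opprB sqrrN lerDl sqr_ge0.
- rewrite -ler_sqr ?nnegrE ?(ltW eps0)// real_normK ?num_real//; apply: le_trans le.
  by rewrite -[in leLHS]opprB sqrrN lerDr sqr_ge0.
Qed.

Lemma in_range_down N i j : (i <= j)%N -> in_range N j -> in_range N i.
Proof. by case: N => //= n; exact: leq_ltn_trans. Qed.

Lemma blaschke_kernel (N : option nat) (lam : nat -> C) (g : nat -> R -> C) :
  (forall k, in_range N k -> Re (lam k) < 0) ->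
  (\sum_(0 <= k <oo | in_range N k) `|Re (lam k)|%:E < +oo)%E ->
  Defs.orthonormal (in_range N) g ->
  gram_schmidt (in_range N) (fun k => exponent (lam k)) g ->
  exists k, [/\ L2 k, (forall x, x < 0 -> k x = 0) &
    forall z, 0 < Re z -> laplace k z = blaschke N lam z - 1].
Proof.
move=> lam0 slam og gs; set J := in_range N.
have down i j : (i <= j)%N -> J j -> J i by exact: in_range_down.
have ex n : exists cn : C, J n -> csq cn = - 2 * Re (lam n) /\
    forall z, 0 < Re z -> laplace (g n) z = cn * partial_blaschke J lam n z / (z - lam n).
  have [Jn|Jn] := boolP (J n); last by exists 0.
  by have [cn ? ?] := gs_laplace down lam0 og gs Jn; exists cn.
have [c cP] := choice ex.
(* Scaled so that d_n times the transform of g_n is the increment of the partial products from n to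
   n + 1. *)
pose d n : C := if J n then (2 * Re (lam n))%:C / c n else 0.
have og' := orthonormal_sys og; set g' := (fun k : nat => _) in og'.
have csq_real (r : R) : csq r%:C = r ^+ 2 by rewrite /csq /= expr0n addr0.
have csqd n : csq (d n) = if J n then 2 * `|Re (lam n)| else 0.
  rewrite /d; case: ifPn => Jn; last by rewrite (csq_real 0) expr0n.
  have [cE _] := cP n Jn; have l0 := lam0 n Jn.
  have cn0 : c n != 0.
    by apply/eqP => c0; move: cE; rewrite c0 (csq_real 0) expr0n /=; lra.
  have : csq ((2 * Re (lam n))%:C / c n) * csq (c n) = (2 * Re (lam n)) ^+ 2.
    by rewrite -csqM divfK// csq_real.
  rewrite cE ltr0_norm// => h.
  apply: (mulIf (x := - 2 * Re (lam n))); first by rewrite mulf_neq0// ?lt_eqF// oppr_eq0.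
  by rewrite h; ring.
set S := (\sum_(0 <= k <oo | _) _)%E in slam.
have S0 : (0 <= S)%E by apply: nneseries_ge0 => n _ _; rewrite lee_fin.
have Sfin : S \is a fin_num by rewrite ge0_fin_numE.
have bd n : \sum_(k < n) csq (d k) <= 2 * fine S.
  have pos k : (0 <= k)%N -> J k -> (0 <= (`|Re (lam k)|)%:E)%E by rewrite lee_fin.
  have := nneseries_lim_ge n pos.
  rewrite -/S -(fineK Sfin) sumEFin lee_fin => le.
  apply: le_trans (ler_wpM2l (ler0n _ 2) le).
  rewrite mulr_sumr [leRHS]big_mkcond [leRHS]big_mkord; apply: ler_sum => k _.
  by rewrite csqd; case: ifP.
have [k0 lk0 k0P] := riesz_fischer og' bd.
(* The limit is only determined almost everywhere; cutting it off gives a representative vanishing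
   at every negative point, with the same transform. *)
pose k := restr `[0%R, +oo[ k0.
have lk : L2 k by exact: L2_restr.
exists k; split=> [//|x x0|z z0]; first by rewrite /k restrE mem_pos leNgt x0.
have lE : L2 (exponent (- conjc z)) by apply: L2_exponent; rewrite !ReImE oppr_lt0.
have lapk : laplace k z = inner k0 (exponent (- conjc z)).
  rewrite laplaceE; apply: eq_cintegral => x; rewrite /k restrE exponentE.
  by case: ifP => //; rewrite conjc0 !mulr0.
pose s n x := \sum_(i < n) d i * g' i x.
have lg' i : L2 (g' i) := og'.1 i.
have ls n : L2 (s n) := L2_sum d (fun i (_ : (i < n)%N) => lg' i).
have bS n : partial_blaschke J lam n.+1 z = partial_blaschke J lam n z *
    (if J n then (z + conjc (lam n)) / (z - lam n) else 1).
  by rewrite /partial_blaschke big_mkcond big_nat_recr//= -big_mkcond.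
have sE n : inner (s n) (exponent (- conjc z)) = partial_blaschke J lam n z - 1.
  rewrite /s inner_suml//; elim: n => [|n IH].
    by rewrite big_ord0 /partial_blaschke big_nil subrr.
  rewrite big_ord_recr /= IH bS.
  have [Jn|Jn] := boolP (J n); last by rewrite /d (negbTE Jn) mul0r addr0 mulr1.
  have g'n : g' n = g n by rewrite /g' (Jn : in_range N n).
  rewrite g'n -laplaceE /d Jn; have [cE ->//] := cP n Jn.
  have l0 := lam0 n Jn.
  have cn0 : c n != 0.
    by apply/eqP => c0; move: cE; rewrite c0 (csq_real 0) expr0n /=; lra.
  have zl : z - lam n != 0 by exact: Re_neq.
  have -> : (2 * Re (lam n))%:C = lam n + conjc (lam n).
    by apply: complexP; rewrite !ReImE /=; ring.
  by field; rewrite cn0 zl.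
(* Convergence of the product is obtained here, from norm convergence of the partial sums and
   Cauchy-Schwarz. The 1 added to the squared norm keeps the divisor positive. *)
have [|cR cI] := @cvg_csq (partial_blaschke J lam ^~ z) (laplace k z + 1).
  move=> eps eps0.
  have E0 : 0 < sqnorm (exponent (- conjc z)) + 1 by rewrite ltr_wpDl// sqnorm_ge0.
  have [M MP] := k0P _ (divr_gt0 eps0 E0); exists M => n /MP le.
  rewrite (_ : _ - _ = inner (fun x => s n x - k0 x) (exponent (- conjc z))).
    apply: le_trans (cauchy_schwarz (L2B (ls n) lk0) lE) _.
    have := sqnorm_ge0 (L2B (ls n) lk0); have := sqnorm_ge0 lE.
    move: le; rewrite ler_pdivlMr//; nra.
  by rewrite innerBl// sE lapk; ring.
rewrite /blaschke /climit -/J.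
rewrite -[X in X - 1](_ : laplace k z + 1 = _); first by rewrite addrK.
by apply: complexP; [exact/esym/(cvg_lim _ cR)|exact/esym/(cvg_lim _ cI)].
Qed.

End Kernel.

(** * The convolution operator *)

Section Fubini.
Variable R : realType.
Notation C := R[i].
Notation Re := (@complex.Re R).
Notation Im := (@complex.Im R).
Notation mu := (@lebesgue_measure R).
Notation RT := (measurableTypeR R).
Implicit Types (f h : R -> C) (z : C).

(** Integrability is asked of every section, not almost every one, so that the real integrals
    coincide everywhere with the extended-valued marginals. *)
Lemma real_fubini (u : R -> R -> R) :
  measurable_fun setT (fun p : RT * RT => u p.1 p.2) ->
  (\int[mu]_s \int[mu]_x `|(u x s)%:E| < +oo)%E ->
  (forall x, mu.-integrable setT (EFin \o u x)) ->
  (forall s, mu.-integrable setT (EFin \o u^~ s)) ->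
  mu.-integrable setT (EFin \o (fun x => Rintegral mu setT (u x))) /\
  Rintegral mu setT (fun x => Rintegral mu setT (u x)) =
  Rintegral mu setT (fun s => Rintegral mu setT (u^~ s)).
Proof.
move=> m_ fin ix is_.
pose f (p : RT * RT) : \bar R := (u p.1 p.2)%:E.
have mf : measurable_fun setT f by exact/measurable_EFinP.
have if_ : (mu \x mu)%E.-integrable setT f by apply/(integrable21ltyP mu mu mf).
have e1 x : (Rintegral mu setT (u x))%:E = fubini_F mu f x.
  by rewrite /Rintegral fineK//; exact: integrable_fin_num (ix x).
have e2 s : (Rintegral mu setT (u^~ s))%:E = fubini_G mu f s.
  by rewrite /Rintegral fineK//; exact: integrable_fin_num (is_ s).
split.
  rewrite (_ : _ \o _ = fubini_F mu f); last by apply/funext => x; exact: e1.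
  exact: integrable_fubini_F.
rewrite /Rintegral -/(Rintegral _ _ _); congr fine.
transitivity (\int[mu]_x fubini_F mu f x)%E.
  by apply: eq_integral => x _; exact: e1.
transitivity (\int[mu]_x fubini_G mu f x)%E; first exact: Fubini.
by apply: eq_integral => s _; rewrite -e2.
Qed.

Lemma complex_fubini (Phi : R -> R -> C) (G : R -> R -> R) :
  measurable_fun setT (fun p : RT * RT => Re (Phi p.1 p.2)) ->
  measurable_fun setT (fun p : RT * RT => Im (Phi p.1 p.2)) ->
  measurable_fun setT (fun p : RT * RT => G p.1 p.2) ->
  (forall x s, 0 <= G x s) ->
  (forall x s, csq (Phi x s) <= G x s ^+ 2) ->
  (\int[mu]_s \int[mu]_x (G x s)%:E < +oo)%E ->
  (forall x, cint (Phi x)) -> (forall s, cint (Phi^~ s)) ->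
  cint (fun x => cintegral setT (Phi x)) /\
  cintegral setT (fun x => cintegral setT (Phi x)) =
  cintegral setT (fun s => cintegral setT (Phi^~ s)).
Proof.
move=> mR mI mG G0 le fin ix is_.
have key y x s : y ^+ 2 <= csq (Phi x s) -> `|y| <= G x s.
  move=> yf; rewrite -(ger0_norm (G0 x s)) -ler_sqr ?nnegrE// !real_normK ?num_real//.
  exact: le_trans (le _ _).
have bnd (u : R -> R -> R) : measurable_fun setT (fun p : RT * RT => u p.1 p.2) ->
    (forall x s, `|u x s| <= G x s) -> (\int[mu]_s \int[mu]_x `|(u x s)%:E| < +oo)%E.
  move=> mu_ uG; apply: le_lt_trans fin.
  have mabs : measurable_fun setT (fun p : RT * RT => `|(u p.1 p.2)%:E|%E).
    by apply: measurableT_comp => //; exact/measurable_EFinP.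
  have mGe : measurable_fun setT (fun p : RT * RT => (G p.1 p.2)%:E) by exact/measurable_EFinP.
  apply: ge0_le_integral => //.
  - by move=> s _; exact: integral_ge0.
  - exact: (measurable_fun_fubini_tonelli_G (fun p : RT * RT => `|(u p.1 p.2)%:E|%E)).
  - apply: (measurable_fun_fubini_tonelli_G (fun p : RT * RT => (G p.1 p.2)%:E)) => //.
    by move=> p; rewrite lee_fin.
  - move=> s _; apply: ge0_le_integral => //.
    + exact: (measurableT_comp mabs (measurable_pair2 s)).
    + by exact: (measurableT_comp mGe (measurable_pair2 s)).
    + by move=> x _; rewrite lee_fin uG.
have [iR eR] := real_fubini mR (bnd _ mR (fun x s => key _ _ _ (ler_wpDr (sqr_ge0 _) (lexx _))))
  (fun x => (ix x).1) (fun s => (is_ s).1).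
have [iI eI] := real_fubini mI (bnd _ mI (fun x s => key _ _ _ (ler_wpDl (sqr_ge0 _) (lexx _))))
  (fun x => (ix x).2) (fun s => (is_ s).2).
split; first by split.
by apply: complexP.
Qed.

End Fubini.

(** * Convolution with a kernel over a bounded window *)

Section Convolution.
Variable R : realType.
Notation C := R[i].
Notation Re := (@complex.Re R).
Notation Im := (@complex.Im R).
Notation mu := (@lebesgue_measure R).
Notation RT := (measurableTypeR R).
Implicit Types (f h : R -> C) (z : C).

(** [T i] is the image of [e i] under the integral operator with kernel conj (kap x s), so that
    T_i(x) is, up to conjugation, a Fourier coefficient of the slice [kap x]. *)
Lemma hilbert_schmidt_kernel J (e : nat -> R -> C) (kap : R -> R -> C) (T : nat -> R -> C) n :
  orthosys J e -> (forall x, L2 (kap x)) -> (forall n, L2 (T n)) ->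
  (forall n x, T n x = inner (e n) (kap x)) ->
  measurable_fun setT (fun x : RT => esqnorm (kap x)) ->
  (\sum_(i < n) (sqnorm (T i))%:E <= \int[mu]_x esqnorm (kap x))%E.
Proof.
move=> oe lk lT TE mk.
rewrite (eq_bigr (fun i : 'I_n => \int[mu]_x (csq (T i x))%:E))%E; last first.
  by move=> i _; rewrite sqnormE.
rewrite -ge0_integral_sum//; last 2 first.
- by move=> i; exact: measurable_int (L2_integrable (lT i)).
- by move=> i x _; rewrite lee_fin csq_ge0.
apply: ge0_le_integral => //.
- by move=> x _; apply: sume_ge0 => i _; rewrite lee_fin csq_ge0.
- by apply: emeasurable_sum => i; exact: measurable_int (L2_integrable (lT i)).
move=> x _; rewrite sumEFin -sqnormE// lee_fin.
apply: le_trans (bessel n oe (lk x)); apply: ler_sum => i _.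
by rewrite TE (inner_conj (lk x) (oe.1 i)) csq_conj.
Qed.

Definition pmeas (Phi : R -> R -> C) :=
  measurable_fun setT (fun p : RT * RT => Re (Phi p.1 p.2)) /\
  measurable_fun setT (fun p : RT * RT => Im (Phi p.1 p.2)).

Lemma pmeasM Phi Psi : pmeas Phi -> pmeas Psi -> pmeas (fun x s => Phi x s * Psi x s).
Proof.
move=> [a b] [c d]; split.
  rewrite (_ : (fun _ => _) = fun p : RT * RT =>
     Re (Phi p.1 p.2) * Re (Psi p.1 p.2) - Im (Phi p.1 p.2) * Im (Psi p.1 p.2)).
    by apply: measurable_funB; exact: measurable_funM.
  by apply/funext => x /=; rewrite Re_mul.
rewrite (_ : (fun _ => _) = fun p : RT * RT =>
   Re (Phi p.1 p.2) * Im (Psi p.1 p.2) + Im (Phi p.1 p.2) * Re (Psi p.1 p.2)).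
  by apply: measurable_funD; exact: measurable_funM.
by apply/funext => x /=; rewrite Im_mul.
Qed.

Lemma pmeas_comp f (phi : RT * RT -> RT) : cmeas f -> measurable_fun setT phi ->
  pmeas (fun x s => f (phi (x, s))).
Proof.
move=> [a b] mphi; split.
  rewrite (_ : (fun _ => _) = (Re \o f) \o phi); last by apply/funext => -[].
  exact: (measurableT_comp a mphi).
rewrite (_ : (fun _ => _) = (Im \o f) \o phi); last by apply/funext => -[].
exact: (measurableT_comp b mphi).
Qed.

Lemma pmeas_fst f : cmeas f -> pmeas (fun x _ => f x).
Proof. by move=> mf; exact: (pmeas_comp mf measurable_fst). Qed.

Lemma pmeas_snd f : cmeas f -> pmeas (fun _ s => f s).
Proof. by move=> mf; exact: (pmeas_comp mf measurable_snd). Qed.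

Lemma pmeas_sub f : cmeas f -> pmeas (fun x s => f (x - s)).
Proof.
move=> mf; apply: (pmeas_comp (phi := fun p : RT * RT => (p.1 - p.2 : R)) mf).
exact: (measurable_funB measurable_fst measurable_snd).
Qed.

Lemma measurable_pmeas_csq Phi : pmeas Phi ->
  measurable_fun setT (fun p : RT * RT => csq (Phi p.1 p.2)).
Proof. by move=> [a b]; apply: measurable_funD; exact: measurable_funX. Qed.

Variables (k : R -> C) (t : R).
Hypotheses (lk : L2 k) (k0 : forall x, x < 0 -> k x = 0) (t0 : 0 <= t).

Definition window : R -> C := restr `[0, t] (fun=> 1).

(* The convolution of [k] with the restriction of [f] to [0, t] is the inner
   product of [f] with [conv_kernel x]. *)
Definition conv_kernel x s := window s * conjc (k (x - s)).
Definition wconv f x := inner f (conv_kernel x).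

Lemma cmeas_window : cmeas window.
Proof. by apply: cmeas_restr => //; exact: cmeas_cst. Qed.

Lemma windowE s : window s = if (0 <= s <= t) then 1 else 0.
Proof. by rewrite /window restrE mem_setE in_itv. Qed.

Lemma csq1 : csq (1 : C) = 1. Proof. by rewrite /csq /= expr0n expr1n addr0. Qed.
Lemma csq0 : csq (0 : C) = 0. Proof. by rewrite /csq /= expr0n addr0. Qed.

Lemma L2_window : L2 window.
Proof.
apply: (@L2_dom _ _ (\1_(`[0, t]%classic : set R))).
- exact: cmeas_window.
- move=> x; rewrite windowE indicE mem_setE in_itv/=.
  by case: ifP; rewrite ?csq1 ?csq0.
- have := integrable_indic_itv (0 : R) t true false.
  by [].
Qed.

Lemma L2_window_mul f : L2 f -> L2 (fun s => window s * f s).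
Proof.
move=> lf; apply: (L2_dom _ _ (L2_integrable lf)).
  by apply: cmeasM; [exact: cmeas_window|exact: L2_cmeas].
by move=> x; rewrite /= csqM windowE; case: ifP; rewrite ?csq1 ?csq0 ?mul1r// mul0r csq_ge0.
Qed.

Lemma L2_conjc f : L2 f -> L2 (fun s => conjc (f s)).
Proof.
move=> lf; apply: (L2_dom _ _ (L2_integrable lf)); first exact/cmeas_conj/L2_cmeas.
by move=> x; rewrite csq_conj.
Qed.

Lemma L2_conv_kernel x : L2 (conv_kernel x).
Proof.
apply: L2_window_mul; apply: L2_conjc.
exact: (L2_preserving (preserving_subr x) lk).
Qed.

Lemma pmeas_conv_kernel : pmeas conv_kernel.
Proof.
apply: pmeasM; first exact/pmeas_snd/cmeas_window.
exact: (pmeas_sub (cmeas_conj (L2_cmeas lk))).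
Qed.

Lemma measurable_esqnorm_conv_kernel : measurable_fun setT (fun x : RT => esqnorm (conv_kernel x)).
Proof.
apply: (measurable_fun_fubini_tonelli_F (m2 := mu) (fun p : RT * RT => (csq (conv_kernel p.1 p.2))%:E)).
  by apply/measurable_EFinP; exact: measurable_pmeas_csq pmeas_conv_kernel.
by move=> p; rewrite lee_fin csq_ge0.
Qed.

Lemma integral_csq_shift s : (\int[mu]_x (csq (k (x - s)))%:E = (sqnorm k)%:E)%E.
Proof.
rewrite sqnormE// /esqnorm (ge0_integral_preserving (preserving_addr (- s)) (u := fun x => (csq (k x))%:E))//.
- exact: measurable_int (L2_integrable lk).
- by move=> x; rewrite lee_fin csq_ge0.
Qed.

(** After Tonelli, each s in [0, t] contributes the squared norm of a translate of [k]. *)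
Lemma integral_esqnorm_conv_kernel : (\int[mu]_x esqnorm (conv_kernel x) = (t * sqnorm k)%:E)%E.
Proof.
rewrite (fubini_tonelli (m1 := mu) (m2 := mu) (fun p : RT * RT => (csq (conv_kernel p.1 p.2))%:E))//=; last 2 first.
- by apply/measurable_EFinP; exact: measurable_pmeas_csq pmeas_conv_kernel.
- by move=> p; rewrite lee_fin csq_ge0.
transitivity (\int[mu]_s ((sqnorm k)%:E * (\1_(`[0, t]%classic : set R) s)%:E))%E.
  apply: eq_integral => s _; rewrite -(integral_csq_shift s) indicE mem_setE in_itv/=.
  have [st|st] := boolP (0 <= s <= t); last first.
    rewrite mule0 integral0_eq// => x _.
    by rewrite /conv_kernel windowE (negbTE st) mul0r csq0.
  rewrite mule1; apply: eq_integral => x _.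
  by rewrite /conv_kernel windowE st mul1r csq_conj.
rewrite ge0_integralZl//; last 2 first.
- by apply/measurable_EFinP; exact: measurable_indic.
- by rewrite lee_fin sqnorm_ge0.
rewrite integral_indic// setIT.
have mI : lebesgue_measure (`[0, t]%classic : set R) = t%:E.
  rewrite lebesgue_measure_itv /= lte_fin.
  have [/eqP tE|tn0] := boolP (t == 0); first by rewrite tE ltxx.
  by rewrite lt_neqAle eq_sym tn0 t0 -EFinD subr0.
transitivity ((sqnorm k)%:E * t%:E)%E; first by congr (_ * _)%E.
by rewrite -EFinM mulrC.
Qed.

Lemma conv_neg f x : x < 0 -> wconv f x = 0.
Proof.
move=> x0; rewrite /wconv (_ : conv_kernel x = fun=> 0); last first.
  apply/funext => s; rewrite /conv_kernel windowE; case: ifP => [/andP[s0 _]|_].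
    by rewrite k0 ?conjc0 ?mulr0// subr_lt0 (lt_le_trans x0).
  by rewrite mul0r.
transitivity (inner (fun=> 0 : C) (fun=> 0)); last exact: inner0l.
by apply: eq_cintegral => s; rewrite conjc0 !mulr0.
Qed.

(** By Fubini, each translate of [k] is paired with [E]; moving the shift onto [E] produces the
    factor [E s]. Integrability is part of the conclusion because [L2_conv] extracts measurability
    from it. *)
Lemma conv_inner E f : L2 E -> L2 f ->
  (forall x s, 0 <= x -> 0 <= s -> E (x + s) = E s * E x) ->
  cint (fun x => wconv f x * conjc (E x)) /\
  inner (wconv f) E = inner k E * inner (fun s => window s * f s) E.
Proof.
move=> lE lf Emul.
pose Phi x s := f s * conjc (conv_kernel x s) * conjc (E x).
(* Domination of [Phi] rests on ab <= (a + b)^2 and c <= (c + 1)^2; the window term supplies the 1.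
   By translation invariance the integral of [G] in x is a constant times an integrable function of
   s. *)
pose G x s := (csq (E x) + csq (k (x - s))) * (csq (window s * f s) + csq (window s)).
have pk : pmeas (fun x s => conjc (conv_kernel x s)).
  rewrite (_ : (fun _ => _) = fun x s => window s * k (x - s)).
    by apply: pmeasM; [exact/pmeas_snd/cmeas_window|exact/pmeas_sub/L2_cmeas].
  apply/funext => x; apply/funext => s; rewrite /conv_kernel windowE.
  by case: ifP; rewrite ?mul1r ?conjcK// !mul0r conjc0.
have [mR mI] : pmeas Phi.
  apply: pmeasM; last exact/pmeas_fst/cmeas_conj/L2_cmeas.
  by apply: pmeasM => //; exact/pmeas_snd/L2_cmeas.
have mG : measurable_fun setT (fun p : RT * RT => G p.1 p.2).
  apply: measurable_funM; apply: measurable_funD.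
  - exact: measurable_pmeas_csq (pmeas_fst (L2_cmeas lE)).
  - exact: measurable_pmeas_csq (pmeas_sub (L2_cmeas lk)).
  - exact: measurable_pmeas_csq (pmeas_snd (L2_cmeas (L2_window_mul lf))).
  - exact: measurable_pmeas_csq (pmeas_snd cmeas_window).
have G0 x s : 0 <= G x s by rewrite /G mulr_ge0// addr_ge0// csq_ge0.
have PhiG x s : csq (Phi x s) <= G x s ^+ 2.
  rewrite /Phi /G /conv_kernel !csqM !csq_conj csqM csq_conj exprMn.
  have := csq_ge0 (E x); have := csq_ge0 (k (x - s)); have := csq_ge0 (f s).
  move: (csq (E x)) (csq (k (x - s))) (csq (f s)) => a b c c0 b0 a0.
  have [w|w] : csq (window s) = 1 \/ csq (window s) = 0.
    by rewrite windowE; case: ifP => _; [left|right]; rewrite ?csq1 ?csq0.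
    rewrite w; have h1 : b * a <= (a + b) ^+ 2 by nra.
    have h2 : c <= (c + 1) ^+ 2 by nra.
    rewrite !mul1r (_ : c * b * a = (b * a) * c); last by ring.
    by apply: ler_pM => //; exact: mulr_ge0.
  by rewrite w !(mulr0, mul0r) addr0 expr0n mulr0.
have fin : (\int[mu]_s \int[mu]_x (G x s)%:E < +oo)%E.
  have inner_int s : (\int[mu]_x (G x s)%:E =
      (sqnorm E + sqnorm k)%:E * (csq (window s * f s) + csq (window s))%:E)%E.
    rewrite /G; under eq_integral do rewrite EFinM muleC.
    rewrite ge0_integralZl//; last 3 first.
    - apply/measurable_EFinP; apply: measurable_funD.
        exact: (measurable_csq (L2_cmeas lE)).
      exact: (measurable_csq (L2_cmeas (L2_preserving (preserving_addr (- s)) lk))).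
    - by move=> x _; rewrite lee_fin addr_ge0// csq_ge0.
    - by rewrite lee_fin addr_ge0// csq_ge0.
    rewrite muleC; congr (_ * _)%E.
    under eq_integral do rewrite EFinD.
    rewrite ge0_integralD//.
    - by rewrite EFinD -(integral_csq_shift s) sqnormE.
    - by move=> x _; rewrite lee_fin csq_ge0.
    - exact: measurable_int (L2_integrable lE).
    - by move=> x _; rewrite lee_fin csq_ge0.
    - exact: measurable_int (L2_integrable (L2_preserving (preserving_addr (- s)) lk)).
  under eq_integral do rewrite inner_int.
  apply: integrable_lty => //; apply: integrableZl => //.
  exact: integrableD_fin (L2_integrable (L2_window_mul lf)) (L2_integrable L2_window).
have ix x : cint (Phi x).
  rewrite (_ : Phi x = fun s => conjc (E x) * (f s * conjc (conv_kernel x s))).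
    by apply: cintZ; apply: L2_cint => //; exact: L2_conv_kernel.
  by apply/funext => s; rewrite /Phi mulrC.
have PhiE s x : Phi x s = (window s * f s) * (tshift (- s) k x * conjc (E x)).
  rewrite /Phi /conv_kernel windowE /tshift.
  by case: ifP => _; rewrite ?mul1r ?conjcK ?mulrA// !mul0r conjc0 mulr0 mul0r.
have is_ s : cint (Phi^~ s).
  rewrite (_ : Phi^~ s = fun x => (window s * f s) * (tshift (- s) k x * conjc (E x))).
    by apply: cintZ; apply: L2_cint => //; exact: L2_tshift.
  by apply/funext => x; exact: PhiE.
have [ic eC] := complex_fubini mR mI mG G0 PhiG fin ix is_.
have convE x : wconv f x * conjc (E x) = cintegral setT (Phi x).
  apply: etrans (mulrC _ _) _.
  apply: etrans (esym (cintegralZ (conjc (E x)) (L2_cint lf (L2_conv_kernel x)))) _.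
  by apply: eq_cintegral => s; rewrite /Phi mulrC.
split.
  suff -> : (fun x => wconv f x * conjc (E x)) = (fun x => cintegral setT (Phi x)) by [].
  by apply/funext => x; exact: convE.
have lwf := L2_window_mul lf.
(* Multiplicativity of [E] is only assumed on the half-line; the vanishing of [k] at negative points
   covers the rest. *)
have shiftE s : 0 <= s -> inner (tshift (- s) k) E = conjc (E s) * inner k E.
  move=> s0; apply: (etrans (inner_tshiftl (- s) lk lE)).
  apply: (@etrans _ _ (inner k (tshift s E))); first by rewrite (opprK s).
  apply: etrans (cintegralZ (conjc (E s)) (L2_cint lk lE)).
  apply: eq_cintegral => x.
  have [x0|x0] := leP 0 x; last first.
    by rewrite (k0 x0) !mul0r mulr0.
  rewrite mulrCA /tshift (Emul _ _ x0 s0).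
  by apply: congr1; exact: (rmorphM (@conjc R)).
apply: etrans (eq_cintegral convE) _.
apply: (etrans eC); apply: etrans (cintegralZ (inner k E) (L2_cint lwf lE)).
apply: eq_cintegral => s; apply: etrans (eq_cintegral (PhiE s)) _.
apply: etrans (cintegralZ _ (L2_cint (L2_tshift (- s) lk) lE)) _.
rewrite -/(inner (tshift (- s) k) E).
have [/andP[s0 st]|st] := boolP (0 <= s <= t); last first.
  by rewrite windowE (negbTE st) !mul0r mulr0.
by apply: (etrans (congr1 _ (shiftE s s0))); apply: (etrans (mulrA _ _ _)); exact: mulrC.
Qed.

Lemma exponent_shift (w : C) x s : 0 <= x -> 0 <= s ->
  exponent w (x + s) = exponent w s * exponent w x.
Proof.
move=> x0 s0; rewrite !exponentE !mem_pos x0 s0 addr_ge0// -cexpD; congr cexp.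
by apply: complexP; rewrite !ReImE /=; ring.
Qed.

Lemma laplace_conv f z : L2 f -> 0 < Re z ->
  laplace (wconv f) z = laplace k z * laplace (fun s => window s * f s) z.
Proof.
move=> lf z0; rewrite !laplaceE; apply: (conv_inner _ lf (@exponent_shift _)).2.
by apply: L2_exponent; rewrite !ReImE oppr_lt0.
Qed.

(** By [conv_inner] the product with e^{-x} is integrable, hence measurable, and multiplying by e^x
    recovers the convolution. Its norm is bounded by Cauchy-Schwarz in each slice. *)
Lemma L2_conv f : L2 f -> L2 (wconv f).
Proof.
move=> lf; have lE : L2 (exponent (-1 : C)) by apply: L2_exponent; rewrite ReImE ltrN10.
have [[mr mi] _] := conv_inner lE lf (@exponent_shift _).
have mc : cmeas (fun x => wconv f x * conjc (exponent (-1) x)).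
  by split; [exact: (measurable_EFinP _ _).1 (measurable_int _ mr)|
             exact: (measurable_EFinP _ _).1 (measurable_int _ mi)].
have cE : wconv f = fun x => (wconv f x * conjc (exponent (-1) x)) * cexp (1 * x%:C).
  apply/funext => x; have [x0|x0] := leP 0 x; last by rewrite conv_neg// !mul0r.
  rewrite exponentE mem_pos x0 -mulrA -cexp_conj -cexpD.
  rewrite (_ : _ + _ = 0) ?cexp0 ?mulr1//.
  by apply: complexP; rewrite !ReImE /=; ring.
apply/L2P; split; first by rewrite cE; apply: cmeasM => //; exact: cmeas_cexp.
apply: (@le_lt_trans _ _ (\int[mu]_x ((sqnorm f)%:E * esqnorm (conv_kernel x)))%E).
  apply: ge0_le_integral => //.
  - by move=> x _; rewrite lee_fin csq_ge0.
  - apply/measurable_EFinP; apply: (measurable_csq (f := wconv f)); rewrite cE.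
    by apply: cmeasM => //; exact: cmeas_cexp.
  - by apply: emeasurable_funM => //; exact: measurable_esqnorm_conv_kernel.
  - move=> x _; rewrite -sqnormE; last exact: L2_conv_kernel.
    by rewrite -EFinM lee_fin; apply: cauchy_schwarz => //; exact: L2_conv_kernel.
rewrite ge0_integralZl//; last 3 first.
- exact: measurable_esqnorm_conv_kernel.
- by move=> x _; apply: integral_ge0 => s _; rewrite lee_fin csq_ge0.
- by rewrite lee_fin sqnorm_ge0.
by rewrite integral_esqnorm_conv_kernel ltry.
Qed.

End Convolution.

(** * Operators and the cocycle *)

Section Operators.
Variable R : realType.
Notation C := R[i].
Notation Re := (@complex.Re R).
Notation Im := (@complex.Im R).
Notation mu := (@lebesgue_measure R).
Implicit Types (f h : R -> C) (z : C).

Lemma sqnorm_comb_sub n (c : nat -> C) (F : nat -> R -> C) f :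
  (forall i, (i < n)%N -> L2 (F i)) -> L2 f ->
  sqnorm (fun x => f x - \sum_(i < n) c i * F i x) =
  sqnorm f + Re (\sum_(i < n) c i * \sum_(j < n) conjc (c j) * inner (F i) (F j))
    - 2 * Re (\sum_(i < n) conjc (c i) * inner f (F i)).
Proof.
move=> lF lf; have ls := L2_sum c lF.
rewrite sqnormB// inner_sumr//; congr (_ + Re _ - _).
rewrite inner_suml//; apply: eq_bigr => i _.
by rewrite (inner_sumr c lF (lF i (ltn_ord i))).
Qed.

(** Both sides expand into the same inner products, so approximation by finite combinations is
    transported by an isometry without invoking its linearity, which holds only up to null sets. *)
Lemma isometry_comb n (c : nat -> C) (F TF : nat -> R -> C) f Tf :
  (forall i, L2 (F i)) -> (forall i, L2 (TF i)) -> L2 f -> L2 Tf ->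
  inner Tf Tf = inner f f -> (forall i, inner Tf (TF i) = inner f (F i)) ->
  (forall i j, inner (TF i) (TF j) = inner (F i) (F j)) ->
  sqnorm (fun x => Tf x - \sum_(i < n) c i * TF i x) =
  sqnorm (fun x => f x - \sum_(i < n) c i * F i x).
Proof.
move=> lF lTF lf lTf eff efF eFF.
rewrite (sqnorm_comb_sub c (fun i (_ : (i < n)%N) => lTF i) lTf).
rewrite (sqnorm_comb_sub c (fun i (_ : (i < n)%N) => lF i) lf).
rewrite /sqnorm eff; congr (_ + Re _ - 2 * Re _); apply: eq_bigr => i _.
  by congr (_ * _); apply: eq_bigr => j _; rewrite eFF.
by rewrite efF.
Qed.

Lemma sqnorm_sub_eq0 f h : L2 f -> L2 h -> sqnorm (fun x => f x - h x) = 0 -> eqae f h.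
Proof.
move=> lf lh /(sqnorm_eq0 (L2B lf lh)); apply: aeS => x.
by move/eqP; rewrite subr_eq0 => /eqP.
Qed.

Lemma supported_neg f : Hplus f -> {ae mu, forall x, x < 0 -> f x = 0}.
Proof.
by move=> [_]; apply: aeS => y fy y0; apply: fy; rewrite /= in_itv/= andbT leNgt y0.
Qed.

(** Completeness of [g] is given only inside [complement V], so the sum [u] of the expansion must
    first be placed there; then [v - u] is in the complement and orthogonal to every g_k. *)
Lemma complement_expansion (V : set (R -> C)) (J : pred nat) (g : nat -> R -> C) v :
  (forall f, V f -> L2 f) -> is_orthonormal_basis (complement V) J g -> complement V v ->
  let g' k := if J k then g k else (fun=> 0) in
  forall eps, 0 < eps -> exists N, forall n, (N <= n)%N ->
    sqnorm (fun x => v x - \sum_(k < n) inner v (g' k) * g' k x) <= eps.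
Proof.
move=> VL [og gV complete] [[lv sv] vV] g'.
have og' : orthosys J g' := orthonormal_sys og.
have lg' k : L2 (g' k) := og'.1 k.
pose c k := inner v (g' k).
have [u0 lu0 u0P] := @riesz_fischer _ _ _ c _ og' (fun n => bessel n og' lv).
pose s n x := \sum_(k < n) c k * g' k x.
have ls n : L2 (s n) := L2_sum c (fun i (_ : (i < n)%N) => lg' i).
have sg' : {ae mu, forall x, x < 0 -> forall k, g' k x = 0}.
  have : {ae mu, forall x k, x < 0 -> g' k x = 0}.
    apply: ae_foralln => k; rewrite /g'; case: ifPn => Jk; last by apply: aeW.
    by have [+ _] := gV k Jk; move/supported_neg; apply: aeS => x.
  by apply: aeS => x h x0 k; exact: h.
(* The cut-off puts the limit in [Hplus] and does not increase its distance to the partial sums,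
   which live on the half-line. *)
pose u := restr `[0%R, +oo[ u0.
have lu : L2 u by exact: L2_restr.
have uP eps : 0 < eps -> exists N, forall n, (N <= n)%N -> sqnorm (fun x => s n x - u x) <= eps.
  move=> /u0P[N NP]; exists N => n /NP; apply: le_trans.
  have lsu := L2B (ls n) lu0.
  have lr : L2 (restr `[0%R, +oo[ (fun x => s n x - u0 x)) by exact: L2_restr.
  rewrite (sqnorm_ae (L2B (ls n) lu) lr); last first.
    move: sg'; apply: aeS => x h; rewrite /u !restrE mem_pos.
    have [//|x0] := leP 0 x.
    by rewrite subr0 /s big1// => k _; rewrite h// mulr0.
  apply: sqnorm_le => // x; rewrite restrE; case: ifP => // _.
  by rewrite /csq /= !expr0n addr0 addr_ge0 ?sqr_ge0.
have Hu : Hplus u.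
  split=> //; apply: aeW => x /= x0; rewrite /u restrE; case: ifPn => //.
  by move/set_mem.
(* Inner products pass to the limit; here they are eventually constant. The factor 2 in the
   tolerance makes the contradiction strict. *)
have small f a : L2 f -> (exists M, forall n, (M <= n)%N -> inner (s n) f = a) -> inner u f = a.
  move=> lf [M MP]; apply/eqP; rewrite -subr_eq0; apply/eqP/csq_eq0/eqP.
  rewrite eq_le csq_ge0 andbT leNgt; apply/negP => pos.
  have p1 : 0 < sqnorm f + 1 by rewrite ltr_wpDl// sqnorm_ge0.
  have [N NP] := uP _ (divr_gt0 (divr_gt0 pos p1) (ltr0n _ 2)).
  have le := NP _ (leq_maxl N M).
  have := cauchy_schwarz (L2B (ls (maxn N M)) lu) lf.
  rewrite innerBl// (MP _ (leq_maxr N M)) (_ : csq (a - _) = csq (inner u f - a)); last first.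
    by rewrite /csq !ReImE; ring.
  move: le pos; rewrite -mulrA -invfM ler_pdivlMr ?mulr_gt0//.
  have := sqnorm_ge0 (L2B (ls (maxn N M)) lu); have := sqnorm_ge0 lf.
  nra.
have wV : complement V (fun x => v x - u x).
  split.
    split; first exact: L2B.
    by move: sv Hu.2; apply: aeS2 => x vx ux nx; rewrite vx// ux// subr0.
  move=> h Vh; have lh := VL _ Vh.
  rewrite innerBl// vV// (small h 0) ?subrr//; exists 0%N => n _.
  rewrite (inner_suml c (fun i (_ : (i < n)%N) => lg' i) lh) big1// => k _.
  rewrite /g'; case: ifP => [Jk|_]; last by rewrite inner0l mulr0.
  by have [_ ->//] := gV _ Jk; rewrite mulr0.
have w0 : eqae (fun x => v x - u x) (fun=> 0).
  apply: complete => // k Jk; have lk := og.1 k Jk.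
  have g'k : g' k = g k by rewrite /g' Jk.
  rewrite innerBl// -g'k; apply/eqP; rewrite subr_eq0; apply/eqP/esym.
  apply: small => //; exists k.+1 => n kn.
  rewrite (inner_suml c (fun i (_ : (i < n)%N) => lg' i) (lg' k)).
  rewrite (bigD1 (Ordinal kn))//= big1 => [|i ik]; rewrite og'.2.
    by rewrite eqxx Jk mulr1 addr0.
  have -> : (i == k :> nat) = false by exact: negbTE.
  by rewrite mulr0.
move=> eps /uP[N NP]; exists N => n /NP; apply: le_trans.
have us : eqae (fun x => v x - \sum_(k < n) inner v (g' k) * g' k x) (fun x => u x - s n x).
  by move: w0; apply: aeS => x /eqP; rewrite subr_eq0 => /eqP ->.
rewrite (sqnorm_ae (L2B lv (ls n)) (L2B lu (ls n)) us).
by rewrite !sqnormB// (inner_conj lu (ls n)) Re_conjc; lra.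
Qed.

End Operators.

(** * The multiplier and the term carried by the complement *)

Section Cocycle.
Variable R : realType.
Notation C := R[i].
Notation Re := (@complex.Re R).
Notation Im := (@complex.Im R).
Notation mu := (@lebesgue_measure R).
Implicit Types (f h : R -> C) (z : C).

Variables (N : option nat) (lam : nat -> C) (M PV PVc : op R) (g : nat -> R -> C).
Let V := range_space M.
Let Vc := complement V.
Hypothesis lam0 : forall k, in_range N k -> Re (lam k) < 0.
Hypothesis multM : is_multiplier (blaschke N lam) M.
Hypothesis projV : is_orth_projection V PV.
Hypothesis projVc : is_orth_projection Vc PVc.
Hypothesis basis : is_orthonormal_basis Vc (in_range N) g.
Hypothesis gs : gram_schmidt (in_range N) (fun k => exponent (lam k)) g.

Let VL f : V f -> L2 f. Proof. by case. Qed.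
Let VcL f : Vc f -> L2 f. Proof. by case=> -[]. Qed.

Lemma range_Hplus f : V f -> Hplus f.
Proof.
move=> [lf [h Hh fh]]; split=> //; have [[_ sM] _] := multM Hh.
by move: fh sM; apply: aeS2 => x -> sx /sx.
Qed.

Lemma HplusB f h : Hplus f -> Hplus h -> Hplus (fun x => f x - h x).
Proof.
move=> [lf sf] [lh sh]; split; first exact: L2B.
by move: sf sh; apply: aeS2 => x fx hx nx; rewrite fx// hx// subr0.
Qed.

(** The remainder [w] lies in [Vc], hence is orthogonal to [h - PVc h] and to [PV h], whose
    difference it is. *)
Lemma projection_split h : Hplus h -> eqae h (fun x => PVc h x + PV h x).
Proof.
move=> Hh; have lh := Hh.1.
have [Vp oV] := projV lh; have [Vcp oVc] := projVc lh.
have lp := VL Vp; have lc := VcL Vcp.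
pose w x := h x - PV h x - PVc h x.
have l1 : L2 (fun x => h x - PV h x) by exact: L2B.
have lw : L2 w by exact: L2B.
have Vcw : Vc w.
  split; first by apply: HplusB; [apply: HplusB => //; exact: range_Hplus|exact: Vcp.1].
  by move=> v Vv; rewrite /w innerBl// ?oV// ?Vcp.2// ?subr0//; exact: VL.
have : sqnorm w = 0.
  rewrite /sqnorm {1}/w (_ : (fun x => _) = (fun x => (h x - PVc h x) - PV h x)); last first.
    by apply/funext => x; rewrite addrAC.
  rewrite innerBl//; last exact: L2B.
  rewrite oVc// (inner_conj lw lp) Vcw.2// conjc0 subr0//.
by move=> /(sqnorm_eq0 lw); apply: aeS => x /eqP; rewrite /w !subr_eq add0r => /eqP.
Qed.

Lemma Hplus_window t f : L2 f -> Hplus (restr `[0, t] f).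
Proof.
move=> lf; split; first exact: L2_restr.
apply: aeW => x /= nx; rewrite restrE; case: ifPn => // /set_mem /=.
rewrite in_itv/= => /andP[x0 _]; by move: nx; rewrite in_itv/= x0.
Qed.

Section Kernel.
Variables (k : R -> C).
Hypotheses (lk : L2 k) (k0 : forall x, x < 0 -> k x = 0).
Hypothesis kP : forall z, 0 < Re z -> laplace k z = blaschke N lam z - 1.

(** Both sides are in [Hplus] and have the same transform, Theta L = L + (Theta - 1) L with L the
    transform of the restricted function. *)
Lemma multiplier_conv t f : 0 <= t -> L2 f ->
  eqae (M (restr `[0, t] f)) (fun x => restr `[0, t] f x + wconv k t f x).
Proof.
move=> t0 lf; have Hf := Hplus_window t lf; have [HM lM] := multM Hf.
have lc := L2_conv lk k0 t0 lf.
have Hc : Hplus (wconv k t f).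
  split=> //; apply: aeW => x /= nx; apply: conv_neg => //.
  by rewrite ltNge; apply/negP => x0; apply: nx; rewrite in_itv/= x0.
have wE : (fun s => window t s * f s) = restr `[0, t] f.
  by apply/funext => s; rewrite /window !restrE; case: ifP; rewrite ?mul1r ?mul0r.
have := @laplace_injective R (fun x => M (restr `[0, t] f) x - restr `[0, t] f x - wconv k t f x).
move=> /(_ (HplusB (HplusB HM Hf) Hc)) h.
have {}h : eqae (fun x => M (restr `[0, t] f) x - restr `[0, t] f x - wconv k t f x) (fun=> 0).
  apply: h => r r0; have lE : L2 (exponent (- conjc (r%:C : C))).
    by apply: L2_exponent; rewrite !ReImE oppr_lt0.
  rewrite laplaceE innerBl//; last exact: (HplusB HM Hf).1.
  rewrite innerBl//; [|exact: HM.1|exact: Hf.1].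
  rewrite -!laplaceE lM// laplace_conv// kP// wE; ring.
move: h; apply: aeS => x /eqP; rewrite subr_eq add0r subr_eq => /eqP ->; exact: addrC.
Qed.

(** Supplies the nonzero vector for the contradiction at time 0. If [M] annihilated e^{-x}, Theta
    would vanish on the positive axis and the transform of [k] would be -1 there, although its
    squared modulus at r is at most sqnorm k / (2r). *)
Lemma range_nonzero : exists2 f, Hplus f & ~ eqae (M f) (fun=> 0).
Proof.
have He : Hplus (exponent (-1 : C)) by apply: Hplus_exponent; rewrite ReImE ltrN10.
exists (exponent (-1)) => // M0; have [HM lM] := multM He.
have Th0 r : 0 < r -> blaschke N lam (r%:C) = 0.
  move=> r0; have := lM r%:C r0.
  have lE : L2 (exponent (- conjc (r%:C : C))) by apply: L2_exponent; rewrite !ReImE oppr_lt0.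
  rewrite !laplaceE (inner_ae HM.1 L2_0 lE lE M0 (eqae_refl _)) inner0l.
  rewrite inner_exponent ?ReImE ?ltrN10 ?oppr_lt0// => /esym/eqP.
  rewrite mulf_eq0 => /orP[/eqP//|]; rewrite oppr_eq0 invr_eq0 => /eqP /(congr1 Re).
  by rewrite !ReImE /= => e; exfalso; lra.
(* Large enough for sqnorm k / (2r) < 1, and positive even if [k] is null. *)
have Nk0 := sqnorm_ge0 lk; pose r := sqnorm k + 1.
have r0 : 0 < r by rewrite ltr_wpDl.
have lE : L2 (exponent (- conjc (r%:C : C))) by apply: L2_exponent; rewrite !ReImE oppr_lt0.
have := cauchy_schwarz lk lE; rewrite -laplaceE kP// Th0// sub0r.
rewrite (_ : csq (-1) = 1); last by rewrite /csq !ReImE /=; ring.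
rewrite {2}/sqnorm inner_exponent ?ReImE ?oppr_lt0//.
have -> : - conjc r%:C + conjc (- conjc r%:C) = ((- (2 * r))%:C : C).
  by apply: complexP; rewrite !ReImE /=; ring.
rewrite -(fmorphV (real_complex R)) /= invrN opprK => le.
have : sqnorm k * (2 * r)^-1 < 1 by rewrite ltr_pdivrMr ?mulr_gt0// mul1r /r; lra.
by rewrite ltNge le.
Qed.

End Kernel.

Let lg k : in_range N k -> L2 (g k). Proof. by case: basis => -[lg _] _ _; exact: lg. Qed.

(** The left shift by [t] multiplies e_i by e^{lambda_i t} on the half-line supporting g_n. In the
    expansion of the shifted g_n only the term i = n is not orthogonal to g_n, and [gs_normalized]
    evaluates it. *)
Lemma inner_gs_shift n t : in_range N n -> 0 <= t ->
  inner (g n) (tshift (- t) (g n)) = cexp (lam n * t%:C).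
Proof.
move=> Jn t0; have [og gVc _] := basis.
have down := @in_range_down N.
have [a [an ga]] := gs_span down gs Jn.
have lgn := lg Jn.
have les i : (i < n.+1)%N -> L2 (exponent (lam i)).
  by move=> i_n; apply/L2_exponent/lam0; exact: (down _ n).
have lts i : (i < n.+1)%N -> L2 (tshift t (exponent (lam i))).
  by move=> /les; exact: L2_tshift.
rewrite -inner_tshiftl//.
rewrite (inner_ae (L2_tshift t lgn) (L2_sum a lts) lgn lgn _ (eqae_refl _)); last first.
  exact: (ae_tshift t ga).
rewrite (inner_suml a lts lgn).
have sh i : (i < n.+1)%N ->
    inner (tshift t (exponent (lam i))) (g n) =
    cexp (lam i * t%:C) * conjc (inner (g n) (exponent (lam i))).
  move=> i_n; rewrite -(inner_conj lgn (les _ i_n)) -innerZl; [|exact: les|exact: lgn].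
  apply: cintegral_ae.
  - by apply: L2_cint => //; exact: lts.
  - by apply: L2_cint => //; apply: L2Z; exact: les.
  have := supported_neg (gVc _ Jn).1; apply: aeS => x gx.
  have [x0|x0] := leP 0 x; last by rewrite (gx x0) conjc0 !mulr0.
  by rewrite /tshift exponent_shift// [exponent _ t]exponentE mem_pos t0.
rewrite (bigD1 ord_max)//= big1 ?addr0 => [|i in_]; last first.
  have i_n : (i < n)%N.
    by rewrite ltn_neqAle -ltnS ltn_ord andbT; exact: in_.
  rewrite sh// (gs_orthogonal down lam0 og gs Jn i_n).
  by rewrite conjc0 !mulr0.
rewrite sh// an mulrCA.
have c1 : conjc (1 : C) = 1 by exact: rmorph1.
have -> : (gs_coef lam g n)%:C * conjc (inner (g n) (exponent (lam n))) = 1.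
  by rewrite -c1 -(gs_normalized down lam0 og gs Jn) conjcM conjc_real.
exact: mulr1.
Qed.

(** The phase of [u] cancels that of e^{lambda_n t}, leaving 2 (1 - e^{t Re lambda_n}). With the
    opposite phase a factor cos(2 t Im lambda_n) would remain, and summability would depend on the
    imaginary parts. *)
Lemma gs_shift_norm n t (u : R -> C) : in_range N n -> 0 <= t -> L2 u ->
  eqae u (fun x => cexp (0 +i* (- Im (lam n) * t)) * g n x) ->
  sqnorm (fun x => u x - tshift (- t) (g n) x) <= 2 * t * `|Re (lam n)|.
Proof.
move=> Jn t0 lu ue; have lgn := lg Jn; have [og _ _] := basis.
have lS := L2_tshift (- t) lgn.
have lz := L2Z (cexp (0 +i* (- Im (lam n) * t))) lgn.
rewrite (sqnorm_ae (L2B lu lS) (L2B lz lS)); last by move: ue; apply: aeS => x ->.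
have g1 : sqnorm (g n) = 1 by rewrite /sqnorm og.2// eqxx.
have s1 : csq (cexp (0 +i* (- Im (lam n) * t))) = 1.
  by rewrite csq_cexp [Re _]/= expR0 expr1n.
have e : cexp (0 +i* (- Im (lam n) * t)) * cexp (lam n * t%:C) = (expR (Re (lam n) * t))%:C.
  rewrite -cexpD -cexp_real; congr cexp.
  by apply: complexP; rewrite !ReImE /=; ring.
rewrite sqnormB// sqnormZ// sqnorm_tshift// g1 innerZl// inner_gs_shift// s1 e [Re _%:C]/=.
rewrite ltr0_norm ?lam0//.
have := expR_ge1Dx (Re (lam n) * t); lra.
Qed.

Hypothesis slam : (\sum_(0 <= k <oo | in_range N k) `|Re (lam k)|%:E < +oo)%E.

Lemma sum_Re_bound : exists2 B : R, 0 <= B &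
  forall n, \sum_(k < n | in_range N k) `|Re (lam k)| <= B.
Proof.
have := slam; set S := (\sum_(0 <= k <oo | _) _)%E => slam'.
have S0 : (0 <= S)%E by apply: nneseries_ge0 => n _ _; rewrite lee_fin.
have Sfin : S \is a fin_num by rewrite ge0_fin_numE.
exists (fine S); first exact: fine_ge0.
move=> n; have pos k : (0 <= k)%N -> in_range N k -> (0 <= (`|Re (lam k)|)%:E)%E by rewrite lee_fin.
have := nneseries_lim_ge n pos.
by rewrite -/S -(fineK Sfin) sumEFin lee_fin big_mkord.
Qed.

Section Compressed.
Variables (U : R -> op R) (t : R).
Hypothesis t0 : 0 <= t.
Hypothesis UK : maps_to Vc (U t).
Hypothesis Uin : forall f h, Vc f -> Vc h -> inner (U t f) (U t h) = inner f h.
Hypothesis Ug : forall k, in_range N k ->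
  eqae (U t (g k)) (cexp (0 +i* (- Im (lam k) * t)) \*o g k).

Let h_ (e : R -> C) := tshift t (restr `[t, +oo[ e).
Let A v := fun x => U t v x - tshift (- t) v x.

Let Hh e : L2 e -> Hplus (h_ e).
Proof.
move=> le; split; first exact/L2_tshift/L2_restr.
apply: aeW => x /= nx; rewrite /h_ /tshift restrE; case: ifPn => // /set_mem /=.
by rewrite in_itv/= andbT lerDr => x0; move: nx; rewrite in_itv/= x0.
Qed.

(** The expansion along the g_k may be infinite, so the bound is proved for its truncations [T K],
    uniformly in [K], and carried over to the [m] given vectors by taking [K] large for them. *)
Lemma compressed_hs : exists2 B : R, 0 <= B & forall (e : nat -> R -> C) m,
  orthosys predT e -> \sum_(n < m) sqnorm (A (PVc (h_ (e n)))) <= B.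
Proof.
have [S S0 SP] := sum_Re_bound.
(* [2 * t * S] bounds the truncations; the outer 2 comes from [sqnormD_le], and the 1 absorbs the
   truncation errors of all [m] vectors. *)
exists (2 * (2 * t * S) + 1); first by rewrite addr_ge0// !mulr_ge0.
move=> e m oe; have [og gVc _] := basis.
have og' := orthonormal_sys og; set g' := (fun k : nat => _) in og'.
have g'E k : in_range N k -> g' k = g k by move=> Jk; rewrite /g' Jk.
have lg' k : L2 (g' k) := og'.1 k.
pose p k := tshift (- t) (g' k).
have lp k : L2 (p k) by exact: L2_tshift.
have op_ : orthosys (in_range N) p by split=> // i j; rewrite inner_tshift// og'.2.
pose Ug' k := if in_range N k then U t (g k) else (fun=> 0).
have lUg' k : L2 (Ug' k).
  by rewrite /Ug'; case: ifPn => [Jk|_]; [apply: VcL; apply: UK; exact: gVc|exact: L2_0].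
pose a k x := Ug' k x - p k x.
have la k : L2 (a k) by exact: L2B.
have Na k : sqnorm (a k) <= if in_range N k then 2 * t * `|Re (lam k)| else 0.
  case: ifPn => Jk.
    rewrite /a /Ug' Jk /p g'E//; apply: gs_shift_norm => //.
      by apply: VcL; apply: UK; exact: gVc.
    exact: Ug.
  have -> : a k = fun=> 0.
    by apply/funext => x; rewrite /a /Ug' /p /tshift /g' (negbTE Jk) subr0.
  by rewrite /sqnorm inner0l.
(* [T K] has finite rank, with slices that are combinations of the orthonormal [p k]; their squared
   norms are sums of the |a_k(x)|^2. *)
pose kap K x s := \sum_(k < K) conjc (a k x) * p k s.
have lkap K x : L2 (kap K x) := L2_sum (fun k => conjc (a k x)) (fun k (_ : (k < K)%N) => lp k).
pose T K n x := \sum_(k < K) inner (e n) (p k) * a k x.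
have lT K n : L2 (T K n) := L2_sum (fun k => inner (e n) (p k)) (fun k (_ : (k < K)%N) => la k).
have TE K n x : T K n x = inner (e n) (kap K x).
  rewrite /kap (inner_sumr (fun k => conjc (a k x)) (fun k (_ : (k < K)%N) => lp k) (oe.1 n)).
  by apply: eq_bigr => k _; rewrite conjcK mulrC.
have esqnormkap K x : esqnorm (kap K x) = (\sum_(k < K | in_range N k) csq (a k x))%:E.
  rewrite -sqnormE// (sqnorm_comb K (fun k => conjc (a k x)) op_).
  by congr EFin; apply: eq_bigr => k _; rewrite csq_conj.
have bT K : \sum_(n < m) sqnorm (T K n) <= 2 * t * S.
  rewrite -lee_fin -sumEFin.
  have mk : measurable_fun setT (fun x : measurableTypeR R => esqnorm (kap K x)).
    rewrite (_ : (fun _ => _) = fun x : measurableTypeR R =>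
       (\sum_(k < K | in_range N k) (csq (a k x))%:E)%E); last first.
      by apply/funext => x; rewrite esqnormkap sumEFin.
    under eq_fun do rewrite -big_filter.
    by apply: emeasurable_sum => k; exact: measurable_int (L2_integrable (la k)).
  apply: le_trans (hilbert_schmidt_kernel m oe (lkap K) (lT K) (TE K) mk) _.
  rewrite (_ : (\int[_]_x _)%E = (\sum_(k < K | in_range N k) sqnorm (a k))%:E); last first.
    transitivity (\int[mu]_x (\sum_(k <- [seq k <- index_enum 'I_K | in_range N (k : 'I_K)])
        (csq (a k x))%:E))%E.
      by apply: eq_integral => x _; rewrite esqnormkap -sumEFin big_filter.
    rewrite ge0_integral_sum//.
    - rewrite big_filter -sumEFin; apply: eq_bigr => k _; by rewrite sqnormE.
    - by move=> k; exact: measurable_int (L2_integrable (la k)).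
    - by move=> k x _; rewrite lee_fin csq_ge0.
  rewrite lee_fin; apply: le_trans (ler_wpM2l _ (SP K)); last by rewrite mulr_ge0.
  rewrite mulr_sumr; apply: ler_sum => k Jk.
  by apply: le_trans (Na k) _; rewrite Jk.
pose v n := PVc (h_ (e n)).
have Vv n : Vc (v n) := (projVc (Hh (oe.1 n)).1).1.
have lv n : L2 (v n) := VcL (Vv n).
have lA n : L2 (A (v n)) by apply: L2B; [apply: VcL; exact: UK|exact: L2_tshift].
(* g_k is in [Vc], which removes the projection; the shift moves to the other side, and p_k is
   supported in [t, +oo[, which removes the restriction. *)
have cE n k : inner (v n) (g' k) = inner (e n) (p k).
  have lh : L2 (h_ (e n)) := (Hh (oe.1 n)).1.
  have [Jk|Jk] := boolP (in_range N k); last first.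
    have z : g' k = fun=> 0 by rewrite /g' (negbTE Jk).
    rewrite /p z (_ : tshift _ _ = fun=> 0)//.
    by rewrite (inner_conj L2_0 (lv n)) (inner_conj L2_0 (oe.1 n)) !inner0l.
  transitivity (inner (h_ (e n)) (g' k)).
    apply/eqP; rewrite eq_sym -subr_eq0 -innerBl//; apply/eqP.
    by apply: (projVc lh).2; rewrite g'E//; exact: gVc.
  have lr : L2 (restr `[t, +oo[ (e n)) by apply: L2_restr => //; exact: oe.1.
  rewrite /h_ inner_tshiftl// -/(p k).
  apply: cintegral_ae; [exact: L2_cint|by apply: L2_cint => //; exact: oe.1|].
  have := ae_tshift (- t) (supported_neg (gVc _ Jk).1); apply: aeS => x gx.
  rewrite restrE mem_setE in_itv/= andbT; case: leP => // xt.
  by rewrite /p /tshift g'E// gx ?subr_lt0// conjc0 !mulr0.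
(* Both [U t] and the shift are isometric on the expansion of [v n], so each error is at most eps
   and the squared norm of their difference at most 2 (eps + eps). *)
have close n eps : 0 < eps -> exists K0, forall K, (K0 <= K)%N ->
    sqnorm (fun x => A (v n) x - T K n x) <= 4 * eps.
  move=> eps0; have [K0 KP] := complement_expansion VL basis (Vv n) eps0.
  exists K0 => K /KP; rewrite -/g' => le.
  pose c k := inner (v n) (g' k).
  have lUv : L2 (U t (v n)) by apply: VcL; exact: UK.
  have lsum (F : nat -> R -> C) : (forall k, L2 (F k)) -> L2 (fun x => \sum_(k < K) c k * F k x).
    by move=> lF; exact: (L2_sum c (fun k (_ : (k < K)%N) => lF k)).
  have e1 : sqnorm (fun x => U t (v n) x - \sum_(k < K) c k * Ug' k x) <= eps.
    rewrite (isometry_comb K c lg' lUg' (lv n) lUv) ?Uin//.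
      move=> k; rewrite /Ug'; case: ifPn => Jk.
        by rewrite Uin ?g'E//; exact: gVc.
      rewrite /g' (negbTE Jk) (inner_conj L2_0 lUv) (inner_conj L2_0 (lv n)) !inner0l//.
    move=> k l; rewrite /Ug'; case: ifPn => Jk; last first.
      by rewrite inner0l /g' (negbTE Jk) inner0l.
    case: ifPn => Jl; first by rewrite Uin ?g'E//; exact: gVc.
    have lUg : L2 (U t (g k)) by apply: VcL; apply: UK; exact: gVc.
    rewrite (inner_conj L2_0 lUg) inner0l /g' (negbTE Jl) Jk.
    by rewrite (inner_conj L2_0 (lg Jk)) inner0l.
  have e2 : sqnorm (fun x => tshift (- t) (v n) x - \sum_(k < K) c k * p k x) <= eps.
    rewrite (isometry_comb K c lg' lp (lv n) (L2_tshift (- t) (lv n)))//.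
    - by rewrite inner_tshift.
    - by move=> k; rewrite inner_tshift.
    - by move=> k l; rewrite inner_tshift.
  rewrite (_ : (fun x => A (v n) x - T K n x) =
    fun x => (U t (v n) x - \sum_(k < K) c k * Ug' k x) -
             (tshift (- t) (v n) x - \sum_(k < K) c k * p k x)).
    apply: le_trans (sqnormB_le (L2B lUv (lsum _ lUg')) (L2B (L2_tshift (- t) (lv n)) (lsum _ lp))) _.
    lra.
  apply/funext => x; rewrite /A /T.
  have -> : \sum_(k < K) inner (e n) (p k) * a k x =
      \sum_(k < K) c k * Ug' k x - \sum_(k < K) c k * p k x.
    by rewrite -sumrB; apply: eq_bigr => k _; rewrite -cE mulrBr.
  ring.
(* The factor 8 is the 4 of [close] times the 2 of [sqnormD_le]; the m errors then add up to m / (m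
   + 1) <= 1. *)
have eps0 : 0 < (8 * (m%:R + 1))^-1 :> R by rewrite invr_gt0 mulr_gt0// ltr_wpDl.
have [K0 K0P] := choice (fun n => close n _ eps0).
pose K := \max_(n < m) K0 n.
have bn (n : 'I_m) : sqnorm (A (v n)) <= 2 * sqnorm (T K n) + (m%:R + 1)^-1.
  have KK : (K0 n <= K)%N by exact: (leq_bigmax n).
  have le := K0P n K KK.
  rewrite (_ : A (v n) = fun x => T K n x + (A (v n) x - T K n x)); last first.
    by apply/funext => x; rewrite addrC subrK.
  apply: le_trans (sqnormD_le (lT K n) (L2B (lA n) (lT K n))) _.
  rewrite mulrDr lerD2l; apply: le_trans (ler_wpM2l _ le) _ => //.
  by rewrite invfM !mulrA -[leRHS]mul1r ler_wpM2r ?invr_ge0 ?addr_ge0//; lra.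
apply: le_trans (ler_sum _ (fun n _ => bn n)) _.
rewrite big_split /= -mulr_sumr; apply: lerD; first by rewrite ler_wpM2l.
rewrite sumr_const card_ord -[leLHS]mulr_natr ler_pdivrMl ?ltr_wpDl// mulr1 lerDl//.
Qed.

End Compressed.
End Cocycle.

(** * From bounds on finite sums to the inner cocycle *)

Section Conclusion.
Variable R : realType.
Notation C := R[i].
Notation Re := (@complex.Re R).
Notation Im := (@complex.Im R).
Notation mu := (@lebesgue_measure R).
Implicit Types (f h : R -> C) (z : C).

Lemma orthonormal_basis_sys (e : nat -> R -> C) :
  is_orthonormal_basis (@L2 R) predT e -> orthosys predT e.
Proof.
by move=> [[le ee] _ _]; split=> [k|k l]; [exact: le|rewrite andbT; exact: ee].
Qed.

(** If T psi = phi then A phi = psi, and [T] maps phi and psi to T phi and phi while preserving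
    their distance. *)
Lemma adjoint_unitary (T A : op R) phi : is_unitary_on (@L2 R) T -> is_adjoint T A ->
  L2 phi -> sqnorm (fun x => A phi x - phi x) = sqnorm (fun x => T phi x - phi x).
Proof.
move=> [TK _ Tin Tsurj] [AK adj] lp; have [psi lpsi psiE] := Tsurj _ lp.
have lA := AK _ lp; have lT := TK _ lp; have lTpsi := TK _ lpsi.
have AE : eqae (A phi) psi.
  have lw := L2B lA lpsi; apply: sqnorm_sub_eq0 => //.
  rewrite /sqnorm innerBr// -adj// -[inner _ psi](Tin _ _ lw lpsi).
  rewrite (inner_ae (TK _ lw) (TK _ lw) lTpsi lp (eqae_refl _) psiE) subrr//.
rewrite (sqnorm_ae (L2B lA lp) (L2B lpsi lp)); last first.
  by move: AE; apply: aeS => x ->.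
rewrite [RHS](sqnorm_ae (L2B lT lp) (L2B lT lTpsi)); last first.
  by move: psiE; apply: aeS => x ->.
by rewrite !sqnormB// /sqnorm !Tin// (inner_conj lp lpsi) Re_conjc; ring.
Qed.

Lemma bounded_hilbert_schmidt (T : op R) : is_unitary_on (@L2 R) T ->
  (exists B, forall e m, orthosys predT e ->
    \sum_(n < m) sqnorm (fun x => T (e n) x - e n x) <= B) ->
  hilbert_schmidt (fun f => T f \- f).
Proof.
move=> [TK Tlin Tin _] [B bB].
have lD f : L2 f -> L2 (T f \- f) by move=> lf; apply: L2B => //; exact: TK.
split=> //.
- move=> a f h lf lh; have := Tlin a f h lf lh; apply: aeS => x /= ->; ring.
- exists 2 => f lf; have lT := TK _ lf.
  rewrite -ler_sqr ?nnegrE ?mulr_ge0 ?sqrtr_ge0// exprMn !norm2_csq//; last exact: lD.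
  apply: le_trans (sqnormB_le lT lf) _.
  by rewrite {1}/sqnorm Tin// -/(sqnorm f) -natrX; lra.
move=> e be; have oe := orthonormal_basis_sys be.
apply: (@le_lt_trans _ _ B%:E); last exact: ltry.
apply: lime_le; first by apply: is_cvg_nneseries => n _ _; rewrite lee_fin sqr_ge0.
apply: nearW => m; rewrite sumEFin lee_fin big_mkord; apply: le_trans (bB e m oe).
by apply: ler_sum => n _; rewrite norm2_csq//; apply: lD; exact: oe.1.
Qed.

Section InnerCocycle.
Variables (N : option nat) (lam : nat -> C) (M PV PVc : op R) (g : nat -> R -> C).
Let V := range_space M.
Let Vc := complement V.
Hypothesis lam0 : forall k, in_range N k -> Re (lam k) < 0.
Hypothesis slam : (\sum_(0 <= k <oo | in_range N k) `|Re (lam k)|%:E < +oo)%E.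
Hypothesis multM : is_multiplier (blaschke N lam) M.
Hypothesis projV : is_orth_projection V PV.
Hypothesis projVc : is_orth_projection Vc PVc.
Hypothesis basis : is_orthonormal_basis Vc (in_range N) g.
Hypothesis gs : gram_schmidt (in_range N) (fun k => exponent (lam k)) g.
Variables U W : R -> op R.
Hypothesis unU : unitary_semigroup Vc U.
Hypothesis cocW : markovian_cocycle W.

Let VcL f : Vc f -> L2 f. Proof. by case=> -[]. Qed.

(* At time 0 the formula with [- PV] sends every vector of the range of [M] to
   its opposite, whereas [W 0] is the identity. *)
Lemma minus_projection_absurd :
  extends_to_cocycle (fun t f => U t (PVc (tshift t f)) \- PV f) M W -> False.
Proof.
move=> [WE _ _]; have [og _ _] := basis.
have [k [lk k0 kP]] := blaschke_kernel lam0 slam og gs.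
have [f0 Hf0 nz] := range_nonzero multM lk kP; apply: nz.
have [HM _] := multM Hf0.
(* A representative vanishing pointwise at negative arguments, so that restriction at t = 0 returns
   the very same function; the operators act on representatives. *)
pose f := restr `[0%R, +oo[ (M f0).
have fM : eqae f (M f0).
  have := supported_neg HM; apply: aeS => x fx; rewrite /f restrE mem_pos.
  by case: leP => // /fx.
have lf : L2 f by apply: L2_restr => //; exact: HM.1.
have Vf : V f by split=> //; exists f0.
have Hf : Hplus f := range_Hplus multM Vf.
have ff : restr `[0%R, +oo[ f = f.
  by apply/funext => x; rewrite /f !restrE; case: (x \in _).
have [unW _ W0 _ _] := cocW.
have := WE 0 f (lexx _) Hf; rewrite oppr0 ff => WfE.
have fE := W0 f lf.
have t0f : tshift 0 f = f by apply/funext => x; rewrite /tshift addr0.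
have PVcz : eqae (PVc f) (fun=> 0).
  have [Vp oV] := projVc lf; have lp := VcL Vp; apply: sqnorm_eq0 => //.
  have := oV _ Vp; rewrite innerBl// (inner_conj lp lf) Vp.2// conjc0 sub0r.
  by move=> /eqP; rewrite oppr_eq0 /sqnorm => /eqP ->.
have PVf : eqae f (PV f).
  have [Vp oV] := projV lf; have lp : L2 (PV f) by case: Vp.
  apply: sqnorm_sub_eq0 => //; rewrite /sqnorm innerBr//; last exact: L2B.
  by rewrite !oV// subr0.
have Uz : eqae (U 0 (PVc f)) (fun=> 0).
  have [unU0 _ _ _] := unU; have [UK _ Uin _] := unU0 0 (lexx _).
  have [Vp _] := projVc lf; apply: sqnorm_eq0; first exact/VcL/UK.
  by rewrite /sqnorm Uin// (inner_ae (VcL Vp) L2_0 (VcL Vp) L2_0 PVcz PVcz) inner0l.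
(* The argument of [M] is null; as [M] is specified through transforms, its image is shown null
   through them. *)
have Mz : eqae (M (restr `[0, 0] f)) (fun=> 0).
  have Hw := Hplus_window 0 lf; have [HMw lM] := multM Hw.
  apply: laplace_injective => // r r0.
  have lE : L2 (exponent (- conjc (r%:C : C))) by apply: L2_exponent; rewrite !ReImE oppr_lt0.
  rewrite lM// !laplaceE (inner_ae Hw.1 L2_0 lE lE _ (eqae_refl _)) ?inner0l ?mulr0//.
  have : mu.-negligible [set 0 : R] by apply/negligibleP => //; exact: lebesgue_measure_set1.
  case=> S [mS S0 aS]; exists S; split => // x nP; apply: aS => /=.
  apply: contrapT => xn; apply: nP => /=; rewrite restrE; case: ifPn => // /set_mem /=.
  by rewrite in_itv/= => /andP[x0 x1]; exfalso; apply: xn; apply/eqP; rewrite eq_le x1 x0.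
apply: (eqae_trans (eqae_sym fM)).
rewrite t0f in WfE.
have h1 := aeS2 (fun x a b => conj a b) Uz Mz.
(* What remains of the formula is f = - f almost everywhere. *)
have h2 := aeS2 (fun x a b => conj a b) PVf (eqae_trans (eqae_sym fE) WfE).
move: h1 h2; apply: aeS2 => x [u0 m0] [pf].
rewrite /= u0 m0 -pf sub0r addr0 => fx.
have : f x *+ 2 = 0 by rewrite mulr2n {1}fx addNr.
by move=> /eqP; rewrite mulrn_eq0 => /eqP.
Qed.

Hypothesis Ug : forall t k, 0 <= t -> in_range N k ->
  eqae (U t (g k)) (cexp (0 +i* (- Im (lam k) * t)) \*o g k).
Hypothesis extW : extends_to_cocycle
  (fun t f => U t (PVc (tshift t f)) \+ tshift (- t) (PV (tshift t f))) M W.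

Lemma backward_bound t : 0 <= t -> exists B, forall e m, orthosys predT e ->
  \sum_(n < m) sqnorm (fun x => W (- t) (e n) x - e n x) <= B.
Proof.
move=> t0; have [og gVc _] := basis.
have [k [lk k0 kP]] := blaschke_kernel lam0 slam og gs.
have [unU0 _ _ _] := unU; have [UK _ Uin _] := unU0 t t0.
have [B B0 BP] := compressed_hs lam0 projVc basis gs slam t0 UK Uin (fun k => Ug t0).
have [unW _ _ _ _] := cocW; have [WK Wlin Win _] := unW (- t).
have [WE Wm _] := extW.
have lc e : L2 e -> L2 (wconv k t e) by exact: (L2_conv lk k0 t0).
pose h_ e := tshift t (restr `[t, +oo[ e).
have Hh e : L2 e -> Hplus (h_ e).
  move=> le; split; first exact/L2_tshift/L2_restr.
  apply: aeW => x /= nx; rewrite /h_ /tshift restrE; case: ifPn => // /set_mem /=.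
  by rewrite in_itv/= andbT lerDr => x0; move: nx; rewrite in_itv/= x0.
pose A v x := U t v x - tshift (- t) v x.
have decomp e : L2 e -> eqae (fun x => W (- t) e x - e x)
    (fun x => A (PVc (h_ e)) x + wconv k t e x).
  move=> le.
  (* Open at 0, so that the two pieces add up to [e] at every point and linearity of [W (- t)] can
     be used for [e] itself. *)
  pose em := restr `]-oo, 0%R[ e; pose ep := restr `[0%R, +oo[ e.
  have lem : L2 em by exact: L2_restr.
  have lep : L2 ep by exact: L2_restr.
  have Hem : Hminus em.
    split=> //; apply: aeW => x /= nx; rewrite /em restrE; case: ifPn => // /set_mem /=.
    by rewrite in_itv/= => x0; exfalso; apply: nx; rewrite in_itv/= ltW.
  have Hep : Hplus ep.
    split=> //; apply: aeW => x /= nx; rewrite /ep restrE; case: ifPn => // /set_mem.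
    by move=> h; exfalso; exact: nx.
  have eE : (1 \*o em) \+ ep = e.
    apply/funext => x; rewrite /= /em /ep !restrE mul1r mem_pos.
    rewrite mem_setE in_itv/=; case: leP => _; by rewrite ?addr0 ?add0r.
  have l1 := Wlin 1 em ep lem lep; rewrite eE in l1.
  have l2 := Wm t em t0 Hem.
  have l3 := WE t ep t0 Hep.
  have r1 : restr `[t, +oo[ ep = restr `[t, +oo[ e.
    apply/funext => x; rewrite /ep !restrE mem_pos mem_setE in_itv/= andbT.
    by case: leP => // tx; rewrite (le_trans t0 tx).
  have r2 : restr `[0, t] ep = restr `[0, t] e.
    apply/funext => x; rewrite /ep !restrE mem_pos mem_setE in_itv/=.
    by case: ifP => // /andP[-> _].
  rewrite r1 r2 in l3.
  have l4 := multiplier_conv multM lk k0 kP t0 le.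
  (* Shifted back, this splits the restriction of [e] to [t, +oo[ along the two projections; the
     [PV] part cancels the second term of the cocycle formula and leaves [A]. *)
  have l5 := ae_tshift (- t) (projection_split multM projV projVc (Hh e le)).
  (* [0, t] and [t, +oo[ share the point t, where [e] would be counted twice. *)
  have nt : {ae mu, forall x, x <> t}.
    have : mu.-negligible [set t] by apply/negligibleP => //; exact: lebesgue_measure_set1.
    case=> S [mS S0 aS]; exists S; split => // x nP; apply: aS => /=.
    by apply: contrapT.
  have q1 := aeS2 (fun x a b => conj a b) l1 l2.
  have q2 := aeS2 (fun x a b => conj a b) l3 l4.
  have q3 := aeS2 (fun x a b => conj a b) l5 nt.
  have q4 := aeS2 (fun x a b => conj a b) q1 q2.
  move: q3 q4; apply: aeS2 => x [p5 xt] [[p1 p2] [p3 p4]].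
  rewrite p1 /= p2 p3 /= p4 mul1r /A -/(h_ e).
  have p5' : restr `[t, +oo[ e x = tshift (- t) (PVc (h_ e)) x + tshift (- t) (PV (h_ e)) x.
    by rewrite -[LHS](congr1 (fun f => f x) (tshiftK t (restr `[t, +oo[ e))); exact: p5.
  have ex : e x = em x + (restr `[t, +oo[ e x + restr `[0, t] e x).
    rewrite /em !restrE !mem_setE !in_itv/= andbT.
    have [x0|x0] := ltP x 0.
      by rewrite [(t <= x)%O]leNgt (lt_le_trans x0 t0) /= !addr0.
    have [tx|xt'] := leP t x; last by rewrite (ltW xt') add0r add0r.
    have -> : (x <= t)%R = false.
      by apply/negP => xt'; apply: xt; apply/eqP; rewrite eq_le tx xt'.
    by rewrite add0r addr0.
  rewrite ex p5'; ring.
exists (2 * (B + t * sqnorm k)) => e m oe.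
have lA n : L2 (A (PVc (h_ (e n)))).
  have Vp := (projVc (Hh _ (oe.1 n)).1).1.
  by apply: L2B; [apply: VcL; exact: UK|apply/L2_tshift/VcL].
have le n : sqnorm (fun x => W (- t) (e n) x - e n x) <=
    2 * (sqnorm (A (PVc (h_ (e n)))) + sqnorm (wconv k t (e n))).
  rewrite (sqnorm_ae _ _ (decomp _ (oe.1 n))).
  - by apply: sqnormD_le => //; exact/lc/oe.1.
  - by apply: L2B; [apply: WK|]; exact: oe.1.
  - by apply: L2D => //; exact/lc/oe.1.
apply: le_trans (ler_sum _ (fun (n : 'I_m) _ => le n)) _.
rewrite -mulr_sumr ler_wpM2l// big_split lerD//; first exact: BP.
rewrite -lee_fin -(integral_esqnorm_conv_kernel lk t0) -sumEFin.
apply: (@hilbert_schmidt_kernel R predT e (conv_kernel k t) (fun n => wconv k t (e n))) => //.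
- by move=> x; exact: L2_conv_kernel.
- by move=> n; exact/lc/oe.1.
- exact: measurable_esqnorm_conv_kernel.
Qed.

Lemma cocycle_inner : inner_cocycle W.
Proof.
have [unW _ _ _ _] := cocW.
move=> t; apply: bounded_hilbert_schmidt => //.
have [t0|t0] := leP t 0.
  have [|B BP] := @backward_bound (- t); first by rewrite oppr_ge0.
  by exists B; rewrite opprK in BP.
have [B BP] := backward_bound (ltW t0); exists B => e m oe.
have [_ _ Wa] := extW; have [A adj WA] := Wa t (ltW t0).
have AK := adj.1.
(* W_t e - e is the shift by t of A phi - phi, and the [phi n] are again orthonormal, so the bound
   at time -t applies to them. *)
pose phi n := tshift (- t) (e n).
have lphi n : L2 (phi n) by apply: L2_tshift; exact: oe.1.
have ophi : orthosys predT phi.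
  by split=> // i j; rewrite inner_tshift; [exact: oe.2|exact: oe.1|exact: oe.1].
apply: le_trans (BP phi m ophi); apply: ler_sum => n _.
have len := oe.1 n; have [WK _ _ _] := unW t.
have lAp := AK _ (lphi n).
rewrite (sqnorm_ae (L2B (WK _ len) len) (L2_tshift t (L2B lAp (lphi n)))).
  by rewrite sqnorm_tshift; [rewrite (adjoint_unitary (unW (- t)) adj)|exact: L2B].
have := WA (e n) len; apply: aeS => x ->; rewrite -/(phi n).
by rewrite /tshift /phi /tshift addrK.
Qed.

End InnerCocycle.
End Conclusion.

Theorem theorem3p2 (R : realType) (N : option nat) (lam : nat -> R[i])
    (M PV PVc : op R) (g : nat -> fn R) :
  let V := range_space M in
  let Vc := complement V in
  N <> Some 0%N ->
  (forall k, in_range N k -> complex.Re (lam k) < 0) ->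
  (\sum_(0 <= k <oo | in_range N k) `|complex.Re (lam k)|%:E < +oo)%E ->
  is_multiplier (blaschke N lam) M ->
  is_orth_projection V PV ->
  is_orth_projection Vc PVc ->
  is_orthonormal_basis Vc (in_range N) g ->
  gram_schmidt (in_range N) (fun k => exponent (lam k)) g ->
  (* With R_t g_k = e^{i Im lambda_k t} g_k and R_t P_Vc S_t - P_V; at t = 0 this
     formula is P_Vc - P_V on H_{0]}, which is not the identity. *)
  (forall U W : R -> op R,
    unitary_semigroup Vc U ->
    (forall t k, 0 <= t -> in_range N k ->
      eqae (U t (g k)) (cexp (0 +i* (complex.Im (lam k) * t)) \*o g k)) ->
    markovian_cocycle W ->
    extends_to_cocycle (fun t f => U t (PVc (tshift t f)) \- PV f) M W ->
    inner_cocycle W)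
  /\
  (* With S_{-t} P_V S_t for - P_V, the form that does define a cocycle, and with
     e^{- i Im lambda_k t}, which matches (S_{-t} g_k, g_k) = e^{conj lambda_k t}. *)
  (forall U W : R -> op R,
    unitary_semigroup Vc U ->
    (forall t k, 0 <= t -> in_range N k ->
      eqae (U t (g k)) (cexp (0 +i* (- complex.Im (lam k) * t)) \*o g k)) ->
    markovian_cocycle W ->
    extends_to_cocycle
      (fun t f => U t (PVc (tshift t f)) \+ tshift (- t) (PV (tshift t f)))
      M W ->
    inner_cocycle W).
Proof.
move=> V Vc _ lam0 slam multM projV projVc basis gs; split=> U W unU Ug cocW extW.
  by case: (minus_projection_absurd lam0 slam multM projV projVc basis gs unU cocW extW).
exact: (cocycle_inner lam0 slam multM projV projVc basis gs unU cocW Ug extW).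
Qed.
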